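(* Let $P$ be a right-angle trapezoid. If $P$ can tile a square, then the number of tiles must be even. That is, if $\Omega\subset\mathbb{R}^2$ is a square and $\Omega=\bigcup_{j=1}^N P_j$, where $P_1,\dots,P_N$ are polygons with pairwise disjoint interiors, each congruent to $P$, then $N$ is even.
   Context: Polygons are closed polygonal regions in the plane. A right-angle trapezoid is a trapezoid with angles $\pi/2,\pi/2,\alpha,\pi-\alpha$ where $0<\alpha<\pi/2$ and the two right angles are adjacent. Two sets $A,B\subset\mathbb{R}^2$ are congruent if $A=g(B)$, where $g$ is a composition of a rotation, possibly a reflection, and a translation. *)

(* Defs.v *)
From HB Require Import structures.
From mathcomp Require Import all_boot all_order all_algebra.
From mathcomp Require Import all_classical all_reals all_analysis.

Set Implicit Arguments.
Unset Strict Implicit.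
Unset Printing Implicit Defensive.

Import Order.TTheory GRing.Theory Num.Theory.
Import numFieldNormedType.Exports.

Local Open Scope classical_set_scope.
Local Open Scope ring_scope.

(* The plane is 'rV[R]_2. Its canonical norm in MathComp-Analysis is the sup
   norm: it induces the usual topology, hence the usual interiors, but lengths
   and angles have to be measured with the Euclidean norm below. *)

Definition vec2 (R : realType) (x y : R) : 'rV[R]_2 :=
  \row_j (if j == 0 then x else y).

Definition dot (R : realType) (u v : 'rV[R]_2) : R :=
  u 0 0 * v 0 0 + u 0 1 * v 0 1.

Definition cross (R : realType) (u v : 'rV[R]_2) : R :=
  u 0 0 * v 0 1 - u 0 1 * v 0 0.

Definition enorm (R : realType) (u : 'rV[R]_2) : R := Num.sqrt (dot u u).

(* The angle XYZ at the vertex Y, in [0, pi] (for X != Y and Z != Y). In a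
   convex polygon with consecutive vertices X, Y, Z this is the interior
   angle at Y. *)
Definition angle (R : realType) (X Y Z : 'rV[R]_2) : R :=
  acos (dot (X - Y) (Z - Y) / (enorm (X - Y) * enorm (Z - Y))).

Definition orient (R : realType) (X Y Z : 'rV[R]_2) : R :=
  cross (Y - X) (Z - X).

(* A, B, C, D are the consecutive vertices of a nondegenerate convex
   quadrilateral, listed counterclockwise or clockwise: all turns are strict
   and in the same direction. In particular the vertices are distinct and the
   boundary is simple. *)
Definition convex_quadrilateral (R : realType) (A B C D : 'rV[R]_2) : Prop :=
  [/\ 0 < orient A B C, 0 < orient B C D,
      0 < orient C D A & 0 < orient D A B] \/
  [/\ orient A B C < 0, orient B C D < 0,
      orient C D A < 0 & orient D A B < 0].

Definition parallel (R : realType) (u v : 'rV[R]_2) : Prop := cross u v = 0.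

Definition trapezoid (R : realType) (A B C D : 'rV[R]_2) : Prop :=
  convex_quadrilateral A B C D /\
  (parallel (B - A) (D - C) \/ parallel (C - B) (A - D)).

Definition convex_hull (R : realType) (V : set 'rV[R]_2) : set 'rV[R]_2 :=
  smallest (@convex_set R 'rV[R]_2) V.

(* For a convex quadrilateral this is the closed region that it bounds. *)
Definition quad_region (R : realType) (A B C D : 'rV[R]_2) : set 'rV[R]_2 :=
  convex_hull [set A; B; C; D].

Definition right_angle_trapezoid (R : realType) (P : set 'rV[R]_2) : Prop :=
  exists (A B C D : 'rV[R]_2) (alpha : R),
    [/\ 0 < alpha < pi / 2,
        trapezoid A B C D,
        P = quad_region A B C D,
        angle D A B = pi / 2 /\ angle A B C = pi / 2 &
        angle B C D = alpha /\ angle C D A = pi - alpha].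

Definition square (R : realType) (Omega : set 'rV[R]_2) : Prop :=
  exists A B C D : 'rV[R]_2,
    [/\ convex_quadrilateral A B C D,
        Omega = quad_region A B C D,
        [/\ enorm (B - A) = enorm (C - B), enorm (C - B) = enorm (D - C) &
            enorm (D - C) = enorm (A - D)] &
        [/\ angle D A B = pi / 2, angle A B C = pi / 2,
            angle B C D = pi / 2 & angle C D A = pi / 2]].

Definition rotation (R : realType) (t : R) (x : 'rV[R]_2) : 'rV[R]_2 :=
  vec2 (cos t * x 0 0 - sin t * x 0 1) (sin t * x 0 0 + cos t * x 0 1).

Definition reflection (R : realType) (x : 'rV[R]_2) : 'rV[R]_2 :=
  vec2 (x 0 0) (- x 0 1).

(* Fixing the axis of reflection, the centre of rotation and the order of
   composition is harmless: the maps below are already all the isometries. *)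
Definition rigid_motion (R : realType) (t : R) (b : bool) (v x : 'rV[R]_2) :
    'rV[R]_2 :=
  rotation t (if b then reflection x else x) + v.

Definition congruent (R : realType) (A B : set 'rV[R]_2) : Prop :=
  exists (t : R) (b : bool) (v : 'rV[R]_2), A = rigid_motion t b v @` B.

(* Main.v *)
Require Import Defs.
From HB Require Import structures.
From mathcomp Require Import all_boot all_order all_algebra.
From mathcomp Require Import all_classical all_reals all_analysis.
From mathcomp Require Import ring lra zify.

(** Let [f] be an additive map from the reals to the rationals and [g] an odd
    integer-valued function of directions. Give a polygon, traversed
    counterclockwise, the sum of [g t * f l] over its edges, where [t] is the unit
    direction and [l] the length of the edge. This weight is additive under
    tilings: along any segment that separates tiles, the edges on the two sides
    have the same total length and opposite directions. For the square
    the weight is zero, since opposite sides cancel.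

    A right-angle trapezoid with leg [h], slanted side [c] and difference of bases
    [d] has weight [f h g t + f d g w - f c g s], where [t], [w] are perpendicular
    unit vectors and [c s = h t + d w]: both bases enter only through [d]. So
    the theorem follows once [f] and [g] are found for which this number is an odd
    integer for every position of the tile: then a sum of [N] odd numbers, up to
    signs, is zero, and [N] is even.

    If [h] or [d] is not a rational multiple of [c], choose [f] with [f c = 0]
    and with [f h], [f d] integers that are not both even, and let [g] be odd on all
    directions, or on exactly one of any two perpendicular directions, according
    to whether one or both of [f h], [f d] are odd. If both ratios are rational,
    [f] can be chosen so that [f h], [f d], [f c] is a Pythagorean triple without
    common factor 2. Then [f c] and exactly one of [f h], [f d] are odd, and one
    needs [g] to be odd on exactly one of [s] and the direction of the odd leg.
    The tangent of the angle between these two lines is [e / x] up to sign, with [e]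
    even and [x] odd, and [e] is not zero because the tile is not a rectangle.
    Composing such turns, in either sense, always gives a tangent [e * y / x'] with
    [x'] odd and [y] of the parity of the number of turns, so an odd
    number of turns never restores a line. Hence the directions can be coloured with
    two colours so that every such turn changes the colour
    ([small_turn_colouring]).

    Additivity is proved by looking along rays. For a point [p] and a unit
    vector [r], the curve [p + s r + s^2 w], where [w] is [r] turned by a quarter turn
    to either side, avoids all edges for small [s > 0], so it runs in exactly one
    tile or outside the square ([tiling_germ]). A convex quadrilateral contains
    the curve on one side of the ray and not on the other exactly when the
    ray runs along one of its edges ([germ_jump]). Summing these
    differences with the coefficients [g r * f (dot r p)] over all vertices [p]
    and all edge directions [r] gives the weight up to sign ([sum_edge_jump]). *)

Set Implicit Arguments.
Unset Strict Implicit.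
Unset Printing Implicit Defensive.

Import Order.TTheory GRing.Theory Num.Theory.
Import numFieldNormedType.Exports.

Local Open Scope classical_set_scope.
Local Open Scope ring_scope.

(** * Orientation and convex quadrilaterals *)

Section Plane.
Variable R : realType.
Implicit Types (A B C D X Y p r u v w x : 'rV[R]_2).

Lemma rV2_eq u v : u 0 0 = v 0 0 -> u 0 1 = v 0 1 -> u = v.
Proof.
move=> e0 e1; apply/rowP => j.
case: j => -[|[|//]] j2; [have -> : Ordinal j2 = 0 by exact: val_inj|
  have -> : Ordinal j2 = 1 by exact: val_inj] => //.
Qed.

Lemma vec2_0 (a b : R) : vec2 a b 0 0 = a. Proof. by rewrite mxE. Qed.
Lemma vec2_1 (a b : R) : vec2 a b 0 1 = b. Proof. by rewrite mxE. Qed.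

Definition rot90 u : 'rV[R]_2 := vec2 (- u 0 1) (u 0 0).

Lemma addv_coord u v i : (u + v) 0 i = u 0 i + v 0 i. Proof. by rewrite mxE. Qed.
Lemma oppv_coord u i : (- u) 0 i = - u 0 i. Proof. by rewrite mxE. Qed.
Lemma scalev_coord a u i : (a *: u) 0 i = a * u 0 i. Proof. by rewrite mxE. Qed.

Definition coordE := (vec2_0, vec2_1, addv_coord, oppv_coord, scalev_coord).

(** The turns at the four vertices already say that each vertex lies strictly to
    the left of every edge that does not contain it: up to cyclic permutation
    these are the same four numbers. *)
Definition ccw A B C D :=
  [/\ 0 < orient A B C, 0 < orient B C D, 0 < orient C D A & 0 < orient D A B].

Definition in_quad A B C D X :=
  [/\ 0 <= orient A B X, 0 <= orient B C X, 0 <= orient C D X &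
      0 <= orient D A X].

Definition inside_quad A B C D X :=
  [/\ 0 < orient A B X, 0 < orient B C X, 0 < orient C D X &
      0 < orient D A X].

Lemma ccw_rot A B C D : ccw A B C D -> ccw B C D A.
Proof. by case. Qed.

Lemma orient_cycle A B C : orient A B C = orient B C A.
Proof. rewrite /orient /cross !coordE; ring. Qed.

Lemma orient_start A B : orient A B A = 0.
Proof. rewrite /orient /cross !coordE; ring. Qed.

Lemma orient_end A B : orient A B B = 0.
Proof. rewrite /orient /cross !coordE; ring. Qed.

Lemma conv_rV2 (l : {i01 R}) X Y :
  conv l (X : convex_lmodType 'rV[R]_2) Y =
  l%:num *: X + (1 - l%:num) *: Y :> 'rV[R]_2.
Proof. by []. Qed.

Lemma convex_halfplane A B : @convex_set R 'rV[R]_2 [set X | 0 <= orient A B X].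
Proof.
move=> X Y l /set_mem /= hX /set_mem /= hY; apply/mem_set => /=.
have -> : orient A B (conv l X Y) =
  l%:num * orient A B X + (1 - l%:num) * orient A B Y.
  rewrite conv_rV2 /orient /cross !coordE; ring.
have [l0 l1] : 0 <= l%:num /\ l%:num <= 1 by split.
by rewrite addr_ge0 // mulr_ge0 // subr_ge0.
Qed.

(** The three orientations of [X] are, up to the common factor
    [orient A B C], its barycentric coordinates. *)
Lemma hull_triangle (V : set 'rV[R]_2) A B C X : V A -> V B -> V C ->
  0 < orient A B C -> 0 <= orient A B X -> 0 <= orient B C X ->
  0 <= orient C A X -> convex_hull V X.
Proof.
move=> VA VB VC pos hc ha hb.
have cvx K : @convex_set R 'rV[R]_2 K -> forall Y Z (a b : R), K Y -> K Z ->
    0 <= a -> 0 <= b -> a + b = 1 -> K (a *: Y + b *: Z).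
  move=> cK Y Z a b KY KZ a0 b0 ab1.
  have a1 : 0 <= a <= 1 by rewrite a0 /=; lra.
  have := cK Y Z (Itv01 a0 (andP a1).2) (mem_set KY) (mem_set KZ).
  move/set_mem; rewrite conv_rV2 /=.
  by have -> : 1 - a = b by lra.
move=> K [cK VK].
have sumE : orient B C X + orient C A X + orient A B X = orient A B C.
  by rewrite /orient /cross !coordE; ring.
set c := orient A B X in hc sumE *; set a := orient B C X in ha sumE *.
set b := orient C A X in hb sumE *; set s := orient A B C in pos sumE *.
have XE : s *: X = a *: A + b *: B + c *: C.
  by rewrite /s /a /b /c; apply: rV2_eq; rewrite /orient /cross !coordE; ring.
have s0 : s != 0 by rewrite gt_eqF.
(* [X] is an average of [C] and of a point of [AB], unless it is [C] itself *)
have [ab0|abN0] := eqVneq (a + b) 0.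
  have a0 : a = 0 by lra.
  have b0 : b = 0 by lra.
  have cs : c = s by lra.
  suff -> : X = C by exact: VK.
  by apply: (scalerI s0); rewrite XE a0 b0 cs !scale0r !add0r.
have abp : 0 < a + b by lra.
have -> : X = ((a + b) / s) *: ((a / (a + b)) *: A + (b / (a + b)) *: B)
               + (c / s) *: C.
  apply: (scalerI s0); rewrite XE scalerDr !scalerA.
  rewrite [s * (c / s)]mulrC divfK // [s * (_ / s)]mulrC divfK //.
  rewrite scalerDr !scalerA ![(a + b) * _]mulrC !divfK //.
apply: (cvx) => //.
- apply: (cvx) => //; try exact: VK.
  + by rewrite divr_ge0 // ltW.
  + by rewrite divr_ge0 // ltW.
  + by rewrite -mulrDl divff.
- exact: VK.
- by rewrite divr_ge0 // ltW.
- by rewrite divr_ge0 // ltW.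
- by rewrite -mulrDl sumE divff.
Qed.

(** Half-planes are convex, which gives one inclusion. Conversely the diagonal
    [AC] cuts the quadrilateral into two triangles. *)
Lemma quad_regionE A B C D : ccw A B C D ->
  quad_region A B C D = [set X | in_quad A B C D X].
Proof.
move=> [h1 h2 h3 h4]; apply/seteqP; split=> X /=.
  move=> hX; split; apply: (smallest_sub (@convex_halfplane _ _) _ hX);
  move=> _ /= [[[->|->]|->]|->]; rewrite ?orient_start ?orient_end //;
  by [exact: ltW|rewrite orient_cycle ltW|rewrite -orient_cycle ltW].
move=> [k1 k2 k3 k4].
have mA : [set A; B; C; D] A by do ?[left].
have mB : [set A; B; C; D] B by left; left; right.
have mC : [set A; B; C; D] C by left; right.
have mD : [set A; B; C; D] D by right.
have [s|s] := leP 0 (orient C A X).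
  exact: (@hull_triangle _ A B C).
apply: (@hull_triangle _ A C D) => //.
- by rewrite orient_cycle.
- by move: s; rewrite /orient /cross !coordE; lra.
Qed.

Lemma orient_continuous A B : continuous (orient A B : 'rV[R]_2 -> R).
Proof.
move=> X; rewrite /orient /cross.
have cc i : (fun Y : 'rV[R]_2 => (Y - A) 0 i) @ X --> ((X - A) 0 i : R).
  have ci : (fun Y : 'rV[R]_2 => Y 0 i) @ X --> (X 0 i : R).
    exact: coord_continuous.
  rewrite !coordE; under eq_fun do rewrite !coordE.
  exact: (cvgB ci (cvg_cst _)).
exact: (cvgB (cvgM (cvg_cst ((B - A) 0 0 : R)) (cc 1))
  (cvgM (cvg_cst ((B - A) 0 1 : R)) (cc 0))).
Qed.

Lemma inside_quad_interior A B C D X : ccw A B C D -> inside_quad A B C D X ->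
  interior (quad_region A B C D) X.
Proof.
move=> cc [k1 k2 k3 k4]; rewrite quad_regionE //.
have nb A' B' : 0 < orient A' B' X -> \forall Y \near X, 0 < orient A' B' Y.
  move=> h; apply: (@orient_continuous A' B' X [set y | 0 < y]).
  exact: lt_nbhsr.
have n1 := nb _ _ k1; have n2 := nb _ _ k2.
have n3 := nb _ _ k3; have n4 := nb _ _ k4.
rewrite /interior /=; near=> Y; rewrite /in_quad.
by split; apply: ltW; near: Y.
Unshelve. all: by end_near. Qed.
End Plane.

(** * Germs of curves in a tiling *)

Section Germs.
Variable R : realType.
Implicit Types (A B C D X Y p r u v w x : 'rV[R]_2).

(** The sign of [a + s * b + s ^+ 2 * c] for all small [s > 0]: it is that of
    the first nonzero coefficient. *)
Definition lexpos (a b c : R) : bool :=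
  (0 < a) || ((a == 0) && ((0 < b) || ((b == 0) && (0 < c)))).

Lemma lexpos_near a b c : lexpos a b c ->
  \forall s \near (0 : R)^'+, 0 < a + s * b + s ^+ 2 * c.
Proof.
have small (x y : R) : 0 < x -> \forall s \near (0 : R)^'+, 0 < x + s * y.
  move=> x0; have y0 : 0 < `|y| + 1 by rewrite ltr_wpDl.
  have xy0 : 0 < x / (`|y| + 1) by rewrite divr_gt0.
  near=> s.
  have s0 : 0 < s by near: s; exact: nbhs_right_gt.
  have : s < x / (`|y| + 1) by near: s; exact: nbhs_right_lt.
  rewrite ltr_pdivlMr // => sy.
  have yy : 0 <= y + `|y| by have := ler_norm (- y); rewrite normrN; lra.
  by have := mulr_ge0 (ltW s0) yy; nra.
case/orP => [a0|/andP[/eqP -> /orP[b0|/andP[/eqP -> c0]]]].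
- near=> s.
  have s0 : 0 < s by near: s; exact: nbhs_right_gt.
  have s1 : s < 1 by near: s; exact: nbhs_right_lt.
  have : 0 < a + s * (- (`|b| + `|c|)) by near: s; exact: small.
  have bb : 0 <= b + `|b| by have := ler_norm (- b); rewrite normrN; lra.
  have cc : 0 <= s * c + `|c|.
    have := ler_norm (- (s * c)); rewrite normrN normrM (gtr0_norm s0).
    have := normr_ge0 c; nra.
  have := mulr_ge0 (ltW s0) bb; have := mulr_ge0 (ltW s0) cc; nra.
- near=> s.
  have s0 : 0 < s by near: s; exact: nbhs_right_gt.
  have : 0 < b + s * c by near: s; exact: small.
  nra.
- near=> s.
  have s0 : 0 < s by near: s; exact: nbhs_right_gt.
  rewrite mulr0 !add0r; apply: mulr_gt0 => //; exact: exprn_gt0.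
Unshelve. all: by end_near. Qed.

Lemma lexposN a b c : [|| a != 0, b != 0 | c != 0] ->
  ~~ lexpos a b c -> lexpos (- a) (- b) (- c).
Proof.
by rewrite /lexpos !oppr_gt0 !oppr_eq0; case: (ltgtP a 0) => //=;
  case: (ltgtP b 0) => //=; case: (ltgtP c 0).
Qed.

(** Whether the curve [p + s r + s^2 w] runs strictly to the left of [AB] for
    all small [s > 0]. When [r] and [w] are independent it cannot stay on a
    line, so each quadrilateral eventually has the curve in its interior
    or in its complement. *)
Definition germ_left A B p r w :=
  lexpos (orient A B p) (cross (B - A) r) (cross (B - A) w).

Definition germ_in A B C D p r w :=
  [&& germ_left A B p r w, germ_left B C p r w, germ_left C D p r w &
      germ_left D A p r w].

Definition germ p r w (s : R) : 'rV[R]_2 := p + s *: r + s ^+ 2 *: w.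

Lemma germ_in_rot A B C D p r w :
  germ_in A B C D p r w = germ_in B C D A p r w.
Proof. by rewrite /germ_in; do 4 case: germ_left. Qed.

Lemma orient_germ A B p r w s : orient A B (germ p r w s) =
  orient A B p + s * cross (B - A) r + s ^+ 2 * cross (B - A) w.
Proof. by rewrite /germ /orient /cross !coordE; ring. Qed.

Lemma orient_AAB A B : orient A A B = 0.
Proof. by rewrite /orient /cross !coordE; ring. Qed.

(** A curve that stays on no line is eventually on one of the two sides of
    [AB]; hence off the left side means on the left of [BA]. *)
Lemma germ_leftPn A B p r w : cross r w != 0 -> A != B ->
  ~~ germ_left A B p r w -> germ_left B A p r w.
Proof.
move=> rw AB /lexposN; rewrite /germ_left -!(addrC (- _)).
have -> : orient B A p = - orient A B p.
  by rewrite /orient /cross !coordE; ring.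
have h u : cross (- B + A) u = - cross (- A + B) u.
  by rewrite /cross !coordE; ring.
rewrite !h; apply; apply: contraT; rewrite !negb_or !negbK => /and3P[_ h1 h2].
(* otherwise [B - A] is parallel to both [r] and [w], hence zero *)
case/eqP: AB; move: rw h1 h2; rewrite /cross !coordE.
set e0 := (- _ + _); set e1 := (- A 0 1 + _).
move=> rw /eqP h1 /eqP h2.
have x0 : e0 * (r 0 0 * w 0 1 - r 0 1 * w 0 0) = 0.
  transitivity (r 0 0 * (e0 * w 0 1 - e1 * w 0 0)
                - w 0 0 * (e0 * r 0 1 - e1 * r 0 0)); first by ring.
  by rewrite h1 h2; ring.
have x1 : e1 * (r 0 0 * w 0 1 - r 0 1 * w 0 0) = 0.
  transitivity (r 0 1 * (e0 * w 0 1 - e1 * w 0 0)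
                - w 0 1 * (e0 * r 0 1 - e1 * r 0 0)); first by ring.
  by rewrite h1 h2; ring.
move: x0 x1 => /eqP; rewrite mulf_eq0 (negPf rw) orbF => /eqP x0.
move=> /eqP; rewrite mulf_eq0 (negPf rw) orbF => /eqP x1.
by apply: rV2_eq; [move: x0|move: x1]; rewrite /e0 /e1; lra.
Qed.

Lemma ccw_neq A B C D : ccw A B C D -> A != B.
Proof. by case=> h _ _ _; apply: contraTneq h => ->; rewrite orient_AAB ltxx. Qed.

Lemma germ_in_near A B C D p r w : ccw A B C D -> germ_in A B C D p r w ->
  \forall s \near (0 : R)^'+, interior (quad_region A B C D) (germ p r w s).
Proof.
move=> cc /and4P[h1 h2 h3 h4]; near=> s; apply: inside_quad_interior => //.
by split; rewrite orient_germ; near: s; exact: lexpos_near.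
Unshelve. all: by end_near. Qed.

Lemma germ_notin_near A B C D p r w : cross r w != 0 ->
  ccw A B C D -> ~~ germ_in A B C D p r w ->
  \forall s \near (0 : R)^'+, ~ quad_region A B C D (germ p r w s).
Proof.
move=> rw.
suff main A' B' C' D' : ccw A' B' C' D' -> ~~ germ_left A' B' p r w ->
    \forall s \near (0 : R)^'+, ~ quad_region A' B' C' D' (germ p r w s).
  have rot A' B' C' D' x : ccw A' B' C' D' ->
      quad_region A' B' C' D' x -> quad_region B' C' D' A' x.
    by move=> c'; rewrite !quad_regionE //; [case|exact: ccw_rot].
  move=> cc; have c2 := ccw_rot cc; have c3 := ccw_rot c2.
  have c4 := ccw_rot c3.
  rewrite /germ_in !negb_and => /or4P[] h.
  - exact: main.
  - by apply: filterS (main _ _ _ _ c2 h) => s hs /(rot _ _ _ _ _ cc).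
  - apply: filterS (main _ _ _ _ c3 h) => s hs /(rot _ _ _ _ _ cc).
    by move=> /(rot _ _ _ _ _ c2).
  - apply: filterS (main _ _ _ _ c4 h) => s hs /(rot _ _ _ _ _ cc).
    by move=> /(rot _ _ _ _ _ c2) /(rot _ _ _ _ _ c3).
move=> cc /(germ_leftPn rw (ccw_neq cc)) /lexpos_near.
apply: filterS => s; rewrite -orient_germ quad_regionE // => hs [h _ _ _].
by move: hs h; rewrite /orient /cross !coordE; lra.
Qed.

(** Follow the curve far enough towards [p] that its position with respect to
    every region is decided: if it is in the big region it is in some tile, and
    in the interior of that tile, hence in no other. *)
Lemma tiling_germ N (A B C D : 'I_N -> 'rV[R]_2) A0 B0 C0 D0 p r w :
  cross r w != 0 ->
  ccw A0 B0 C0 D0 -> (forall j, ccw (A j) (B j) (C j) (D j)) ->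
  quad_region A0 B0 C0 D0 =
    \bigcup_(j in [set: 'I_N]) quad_region (A j) (B j) (C j) (D j) ->
  (forall i j : 'I_N, i <> j ->
     interior (quad_region (A i) (B i) (C i) (D i)) `&`
     interior (quad_region (A j) (B j) (C j) (D j)) = set0) ->
  \sum_(j < N) (germ_in (A j) (B j) (C j) (D j) p r w)%:R =
  (germ_in A0 B0 C0 D0 p r w)%:R :> rat.
Proof.
move=> rw c0 cc cover disj.
pose decided (c : bool) (S : set 'rV[R]_2) (s : R) := if c then interior S (germ p r w s)
  else ~ S (germ p r w s).
have [s [s1 s0]] : exists s,
    (forall j, decided (germ_in (A j) (B j) (C j) (D j) p r w)
                       (quad_region (A j) (B j) (C j) (D j)) s) /\
    decided (germ_in A0 B0 C0 D0 p r w) (quad_region A0 B0 C0 D0) s.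
  have near_decided a b c d : ccw a b c d -> \forall s \near (0 : R)^'+,
      decided (germ_in a b c d p r w) (quad_region a b c d) s.
    move=> abcd; rewrite /decided.
    have [h|h] := boolP (germ_in a b c d p r w); first exact: germ_in_near.
    exact: germ_notin_near.
  have all_decided : \forall s \near (0 : R)^'+, forall j : 'I_N,
      decided (germ_in (A j) (B j) (C j) (D j) p r w)
        (quad_region (A j) (B j) (C j) (D j)) s.
    exact: (filter_forall _ (fun j : 'I_N => near_decided _ _ _ _ (cc j))).
  have [s [s1 s0]] := @filter_ex _ _ (at_right_proper_filter (0 : R)) _
    (filterI all_decided (near_decided _ _ _ _ c0)).
  by exists s.
rewrite /decided {decided} in s1 s0.
have sub j : germ_in (A j) (B j) (C j) (D j) p r w ->
    germ_in A0 B0 C0 D0 p r w.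
  move=> h; have := s1 j; rewrite h => /interior_subset hj.
  by move: s0; case: ifPn => // _; rewrite cover; case; exists j.
have [h0|h0] := boolP (germ_in A0 B0 C0 D0 p r w); last first.
  by rewrite big1 // => j _; case: (boolP (germ_in _ _ _ _ _ _ _)) => // /sub;
    rewrite (negPf h0).
move: s0; rewrite h0 => /interior_subset; rewrite cover => -[j _ hj].
have gj : germ_in (A j) (B j) (C j) (D j) p r w.
  by have := s1 j; case: ifPn.
rewrite (bigD1 j) //= gj big1 ?addr0 // => i /eqP ij.
have [gi|//] := boolP (germ_in (A i) (B i) (C i) (D i) p r w).
have := disj i j ij; rewrite -subset0 => /(_ (germ p r w s)) [].
by split; [have := s1 i; rewrite gi|have := s1 j; rewrite gj].
Qed.
End Germs.

(** * Edges seen from the two sides of a ray *)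

Section Edges.
Variable R : realType.
Implicit Types (A B C D X Y p r u v w x : 'rV[R]_2).

Definition dir A B : 'rV[R]_2 := (enorm (B - A))^-1 *: (B - A).

Definition half_open A B p : bool :=
  (orient A B p == 0) && (0 <= dot (B - A) (p - A) < dot (B - A) (B - A)).

(** The edge is closed at its start and open at its end because a ray that
    issues along [AB] from [A] has the polygon on its left, whereas a ray that
    issues from [B] and prolongs [AB] leaves the polygon. *)
Definition edge_germ A B p r : rat := ((r == dir A B) && half_open A B p)%:R.

(** An edge [AB] of a counterclockwise polygon has the polygon on the left of
    the rays along [AB] and on the right of the rays along [BA]. *)
Definition edge_jump A B p r : rat := edge_germ A B p r - edge_germ B A p r.

Lemma dot_ge0 u : 0 <= dot u u.
Proof. by rewrite /dot addr_ge0 // -expr2 sqr_ge0. Qed.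

Lemma dot_eq0 u : (dot u u == 0) = (u == 0).
Proof.
apply/eqP/eqP => [h|->]; last by rewrite /dot !mxE; ring.
move: h; rewrite /dot -!expr2 => /eqP.
rewrite paddr_eq0 ?sqr_ge0 // !sqrf_eq0 => /andP[/eqP h0 /eqP h1].
by apply: rV2_eq; rewrite ?h0 ?h1 mxE.
Qed.

Lemma dot_gt0 u : (0 < dot u u) = (u != 0).
Proof. by rewrite lt_neqAle dot_ge0 andbT eq_sym dot_eq0. Qed.

Lemma enorm_sqr u : enorm u ^+ 2 = dot u u.
Proof. by rewrite sqr_sqrtr // dot_ge0. Qed.

Lemma enorm_gt0 u : (0 < enorm u) = (u != 0).
Proof. by rewrite sqrtr_gt0 dot_gt0. Qed.

Lemma dot_dir A B : A != B -> dot (dir A B) (dir A B) = 1.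
Proof.
rewrite eq_sym -subr_eq0 -enorm_gt0 => h.
have -> : dot (dir A B) (dir A B) = dot (B - A) (B - A) / enorm (B - A) ^+ 2.
  by rewrite /dot /dir !(scalev_coord _ (B - A)); field; rewrite gt_eqF.
by rewrite enorm_sqr divff // gt_eqF // dot_gt0 -enorm_gt0.
Qed.

Lemma enormN u : enorm (- u) = enorm u.
Proof. by rewrite /enorm /dot !coordE !mulrNN. Qed.

Lemma dir_sym A B : dir B A = - dir A B.
Proof. by rewrite /dir -opprB enormN scalerN. Qed.

Lemma parallel_scale u v : u != 0 -> cross u v = 0 ->
  v = (dot u v / dot u u) *: u.
Proof.
move=> u0 uv; have d0 : dot u u != 0 by rewrite dot_eq0.
apply: (scalerI d0); rewrite scalerA [_ * (_ / _)]mulrC divfK //.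
apply: rV2_eq; rewrite !coordE.
  transitivity (dot u v * u 0 0 - u 0 1 * cross u v).
    by rewrite /dot /cross; ring.
  by rewrite uv mulr0 subr0.
transitivity (dot u v * u 0 1 + u 0 0 * cross u v).
  by rewrite /dot /cross; ring.
by rewrite uv mulr0 addr0.
Qed.

Lemma unit_scale (a k : R) : 0 < a -> k ^+ 2 * a ^+ 2 = 1 -> 0 < k -> k = a^-1.
Proof.
move=> a0 h k0; have ka : 0 < k * a by rewrite mulr_gt0.
have : (k * a - 1) * (k * a + 1) = 0.
  by transitivity (k ^+ 2 * a ^+ 2 - 1); [ring|rewrite h subrr].
move/eqP; rewrite mulf_eq0 [X in _ || X]gt_eqF ?addr_gt0 // orbF subr_eq0.
move/eqP=> ka1; apply: (mulIf (lt0r_neq0 a0)).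
by rewrite ka1 mulVf // lt0r_neq0.
Qed.

Lemma dirP A B r : A != B -> dot r r = 1 -> cross (B - A) r = 0 ->
  (r == dir A B) = (0 < dot (B - A) r).
Proof.
rewrite eq_sym -subr_eq0 /dir; set e := B - A => e0 r1 er.
have en : 0 < enorm e by rewrite enorm_gt0.
have ee : 0 < dot e e by rewrite dot_gt0.
have rE := parallel_scale e0 er; set k := _ / _ in rE.
have dE : dot e r = k * dot e e by rewrite /k divfK // gt_eqF.
apply/eqP/idP => [->|d0].
  have -> : dot e ((enorm e)^-1 *: e) = (enorm e)^-1 * dot e e.
    by rewrite /dot !scalev_coord; ring.
  by rewrite mulr_gt0 // invr_gt0.
rewrite rE -(@unit_scale (enorm e) k) //.
  transitivity (dot (k *: e) (k *: e)); last by rewrite -rE.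
  by rewrite enorm_sqr /dot !(scalev_coord k e); ring.
by rewrite /k divr_gt0.
Qed.

Lemma edge_jump0 A B p r :
  ~~ ((orient A B p == 0) && (cross (B - A) r == 0)) -> edge_jump A B p r = 0.
Proof.
have germ0 A' B' : edge_germ A' B' p r != 0 ->
    (orient A' B' p == 0) && (cross (B' - A') r == 0).
  rewrite /edge_germ; case: andP => // -[/eqP -> /andP[-> _]] _ /=.
  by rewrite /dir /cross !scalev_coord; apply/eqP; ring.
move=> h; rewrite /edge_jump.
have -> : edge_germ A B p r = 0 by apply: contraNeq h; exact: germ0.
rewrite sub0r; apply/eqP; rewrite oppr_eq0; apply: contraNT h => /germ0.
rewrite -[in X in _ -> X]oppr_eq0 -[in X in _ && X]oppr_eq0.
by congr (_ && _); congr (_ == 0); rewrite /orient /cross !coordE; ring.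
Qed.

(** When the ray from [p] in direction [r] runs along [AB], only the condition
    of that edge tells the two sides of the ray apart. With [p = A + s (B - A)]
    and [r = k (B - A)], the other three conditions say that [p] lies on the
    edge, the ends being included or not according to the sign of [k]. *)
Lemma jump_on_edge A B C D p r : ccw A B C D -> dot r r = 1 ->
  orient A B p = 0 -> cross (B - A) r = 0 ->
  (germ_in A B C D p r (rot90 r))%:R - (germ_in A B C D p r (- rot90 r))%:R =
  edge_jump A B p r.
Proof.
move=> cc r1 hp hr; have AB := ccw_neq cc.
case: cc => q1 q2 q3 q4.
have BA : B != A by rewrite eq_sym.
have e0 : B - A != 0 by rewrite subr_eq0.
have ee : 0 < dot (B - A) (B - A) by rewrite dot_gt0.
have ee0 : dot (B - A) (B - A) != 0 by rewrite gt_eqF.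
have rE := parallel_scale e0 hr; set k := _ / _ in rE.
have pE : p = A + (dot (B - A) (p - A) / dot (B - A) (B - A)) *: (B - A).
  by rewrite -parallel_scale // addrC subrK.
set s := _ / _ in pE.
have sE : dot (B - A) (p - A) = s * dot (B - A) (B - A) by rewrite /s divfK.
have kE : dot (B - A) r = k * dot (B - A) (B - A) by rewrite /k divfK.
clearbody k s.
have sE' : dot (A - B) (p - B) = (1 - s) * dot (A - B) (A - B).
  rewrite [in LHS]pE /dot !coordE; ring.
have hp' : orient B A p = 0.
  by rewrite -[LHS]opprK -[RHS]oppr0 -hp; congr (- _);
    rewrite /orient /cross !coordE; ring.
have hr' : cross (A - B) r = 0.
  by rewrite -[LHS]opprK -[RHS]oppr0 -hr; congr (- _);
    rewrite /cross !coordE; ring.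
have kE' : dot (A - B) r = - k * dot (B - A) (B - A).
  by rewrite mulNr -kE /dot !coordE; ring.
have eeN : dot (A - B) (A - B) = dot (B - A) (B - A).
  by rewrite /dot !coordE; ring.
have k0 : k != 0.
  apply/eqP => k0; move: r1; rewrite rE k0 scale0r /dot !mxE => /eqP.
  by rewrite mulr0 addr0 eq_sym oner_eq0.
rewrite /edge_jump /edge_germ !dirP // kE kE' /half_open hp hp' eqxx /=.
rewrite sE sE' eeN !(pmulr_lgt0 _ ee) !(pmulr_lge0 _ ee) !(gtr_pMl _ ee).
rewrite oppr_gt0 subr_ge0.
have -> : (1 - s < 1) = (0 < s) by rewrite ltrBlDr ltrDl.
(* the four half-plane conditions, in terms of [s] and [k] *)
have left1 w : germ_left A B p r w = (0 < cross (B - A) w).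
  by rewrite /germ_left /lexpos hp hr !eqxx ltxx.
have lexposE (a b c : R) : b != 0 ->
    lexpos a b c = (0 < a) || ((a == 0) && (0 < b)).
  by rewrite /lexpos => /negPf ->; rewrite orbF.
have left2 w : germ_left B C p r w = (s < 1) || ((s == 1) && (k < 0)).
  have c2 : cross (C - B) r = - k * orient A B C.
    by rewrite rE /orient /cross !coordE; ring.
  have o2 : orient B C p = (1 - s) * orient A B C.
    by rewrite pE /orient /cross !coordE; ring.
  rewrite /germ_left c2 o2 lexposE ?mulf_neq0 ?oppr_eq0 ?(gt_eqF q1) //.
  rewrite !pmulr_lgt0 // subr_gt0 oppr_gt0 mulf_eq0 (gt_eqF q1) orbF subr_eq0.
  by rewrite [1 == s]eq_sym.
have left4 w : germ_left D A p r w = (0 < s) || ((s == 0) && (0 < k)).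
  have c4 : cross (A - D) r = k * orient D A B.
    by rewrite rE /orient /cross !coordE; ring.
  have o4 : orient D A p = s * orient D A B.
    by rewrite pE /orient /cross !coordE; ring.
  rewrite /germ_left c4 o4 lexposE ?mulf_neq0 ?(gt_eqF q4) //.
  by rewrite !pmulr_lgt0 // mulf_eq0 (gt_eqF q4) orbF.
have left3 w : 0 <= s <= 1 -> germ_left C D p r w.
  move=> /andP[s0 s1].
  have o3 : orient C D p = (1 - s) * orient C D A + s * orient B C D.
    by rewrite pE /orient /cross !coordE; ring.
  rewrite /germ_left /lexpos o3; apply/orP; left.
  have [s0'|s0'] := eqVneq s 0; first by rewrite s0' subr0 mul0r mul1r addr0.
  apply: ltr_wpDl.
    by apply: mulr_ge0; [rewrite subr_ge0|exact: ltW].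
  by rewrite mulr_gt0 // lt_neqAle eq_sym s0'.
have cw : cross (B - A) (rot90 r) = k * dot (B - A) (B - A).
  by rewrite -kE /cross /dot /rot90 !coordE; ring.
have cwN : cross (B - A) (- rot90 r) = - k * dot (B - A) (B - A).
  by rewrite mulNr -kE /cross /dot /rot90 !coordE; ring.
rewrite /germ_in !left1 !left2 !left4 cw cwN !pmulr_lgt0 // oppr_gt0.
have both w : 0 <= s <= 1 -> germ_left C D p r w = true by exact: left3.
case: (ltgtP k 0) k0 => // _ _; case: (ltgtP s 0) => //= s0;
  rewrite ?andbF ?andbT //=; case: (ltgtP s 1) => //= s1;
  rewrite ?andbF ?andbT //= ?both ?subr0 //; apply/andP; split; lra.
Qed.
End Edges.

(** * Additivity of edge weights *)

Section Additivity.
Variable R : realType.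
Implicit Types (A B C D X Y p r u v w x : 'rV[R]_2).

Definition along_edge A B p r : bool :=
  (orient A B p == 0) && (cross (B - A) r == 0).

Lemma along_edge_unique A B C D p r : ccw A B C D -> r != 0 ->
  along_edge A B p r -> ~~ along_edge B C p r /\ ~~ along_edge C D p r.
Proof.
move=> [q1 q2 q3 q4] r0 /andP[/eqP hp /eqP hr].
(* two edges along r are parallel, since both are multiples of r *)
have par u v : cross u r = 0 -> cross v r = 0 -> cross u v = 0.
  have swap (a b : 'rV[R]_2) : cross a b = - cross b a.
    by rewrite /cross; ring.
  move=> ur vr; rewrite (parallel_scale r0 (v := u)) ?(swap r) ?ur ?oppr0 //.
  rewrite (parallel_scale r0 (v := v)) ?(swap r) ?vr ?oppr0 //.
  by rewrite /cross !(scalev_coord _ r); ring.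
split; apply/negP => /andP[/eqP kp /eqP kr].
  move: q1; have -> : orient A B C = cross (B - A) (C - B).
    by rewrite /orient /cross !coordE; ring.
  by rewrite par // ltxx.
have AB : A != B by apply: (@ccw_neq _ A B C D).
have e0 : B - A != 0 by rewrite subr_eq0 eq_sym.
have pE : p = A + (dot (B - A) (p - A) / dot (B - A) (B - A)) *: (B - A).
  by rewrite -parallel_scale // addrC subrK.
set s := _ / _ in pE; clearbody s.
have o3 : orient C D p = orient C D A + s * cross (D - C) (B - A).
  by rewrite pE /orient /cross !coordE; ring.
by move: q3; rewrite -kp o3 (par (D - C)) // mulr0 addr0 ltxx.
Qed.

(** The two sides of a ray are distinguished by a quadrilateral only if the
    ray runs along one of its edges, and then along no other. *)
Lemma germ_jump A B C D p r : ccw A B C D -> dot r r = 1 ->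
  (germ_in A B C D p r (rot90 r))%:R - (germ_in A B C D p r (- rot90 r))%:R =
  edge_jump A B p r + edge_jump B C p r + edge_jump C D p r + edge_jump D A p r.
Proof.
move=> cc r1.
have r0 : r != 0 by rewrite -dot_eq0 r1 oner_eq0.
have main A' B' C' D' : ccw A' B' C' D' -> along_edge A' B' p r ->
    (germ_in A' B' C' D' p r (rot90 r))%:R -
    (germ_in A' B' C' D' p r (- rot90 r))%:R =
    edge_jump A' B' p r + edge_jump B' C' p r + edge_jump C' D' p r +
    edge_jump D' A' p r.
  move=> c' h; have [h2 h3] := along_edge_unique c' r0 h.
  have h4 : ~~ along_edge D' A' p r.
    apply: contraL h => h; have c'' := ccw_rot (ccw_rot (ccw_rot c')).
    by have [] := along_edge_unique c'' r0 h.
  rewrite (edge_jump0 h2) (edge_jump0 h3) (edge_jump0 h4) !addr0.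
  by case/andP: h => /eqP hp /eqP hr; exact: jump_on_edge.
have c2 := ccw_rot cc; have c3 := ccw_rot c2; have c4 := ccw_rot c3.
have [h1|h1] := boolP (along_edge A B p r); first exact: main.
have [h2|h2] := boolP (along_edge B C p r).
  by rewrite !(germ_in_rot A) (main _ _ _ _ c2 h2); ring.
have [h3|h3] := boolP (along_edge C D p r).
  by rewrite !(germ_in_rot A) !(germ_in_rot B) (main _ _ _ _ c3 h3); ring.
have [h4|h4] := boolP (along_edge D A p r).
  by rewrite -!(germ_in_rot D) (main _ _ _ _ c4 h4); ring.
rewrite (edge_jump0 h1) (edge_jump0 h2) (edge_jump0 h3) (edge_jump0 h4) !addr0.
suff same A' B' w : ~~ along_edge A' B' p r ->
    germ_left A' B' p r w = germ_left A' B' p r 0.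
  by apply/eqP; rewrite subr_eq0 /germ_in; do 8?[rewrite same //].
rewrite /along_edge /germ_left /lexpos negb_and.
by case/orP => /negPf ->; rewrite ?andbF.
Qed.

(** For additive [f] and odd [g], an edge of length [l] and unit direction [t]
    weighs [g t * f l]. As [f l] is the increment of [p |-> f (dot t p)] along
    the edge, the weight is up to sign a sum over rays of germ jumps, with the coefficient
    [g r * f (dot r p)] for the ray from [p] in direction [r]. *)
Section Weights.
Variables (f : R -> rat) (g : 'rV[R]_2 -> int).
Hypothesis fD : {morph f : x y / x + y}.
Hypothesis gN : forall u, g (- u) = - g u.

Definition edge_weight A B : rat := (g (dir A B))%:~R * f (enorm (B - A)).

Definition quad_weight A B C D : rat :=
  edge_weight A B + edge_weight B C + edge_weight C D + edge_weight D A.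

Lemma additive0 : f 0 = 0.
Proof. by apply: (addIr (f 0)); rewrite -fD !add0r. Qed.

Lemma additiveN (y : R) : f (- y) = - f y.
Proof. by apply/eqP; rewrite -subr_eq0 opprK -fD addNr additive0. Qed.

Lemma edge_weight_sym A B : edge_weight B A = - edge_weight A B.
Proof.
by rewrite /edge_weight dir_sym gN -opprB enormN rmorphN mulNr.
Qed.

(** Inner points of the edge belong to both half-open versions. *)
Lemma half_open_diff A B p : A != B ->
  (half_open A B p)%:R - (half_open B A p)%:R =
  (p == A)%:R - (p == B)%:R :> rat.
Proof.
move=> AB; have BA : B != A by rewrite eq_sym.
have e0 : B - A != 0 by rewrite subr_eq0.
have ee : 0 < dot (B - A) (B - A) by rewrite dot_gt0.
have ee0 : dot (B - A) (B - A) != 0 by rewrite gt_eqF.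
have oBA : orient B A p = - orient A B p.
  by rewrite /orient /cross !coordE; ring.
have [hp|hp] := eqVneq (orient A B p) 0; last first.
  rewrite /half_open oBA oppr_eq0 (negPf hp) /=.
  case: eqP => [pA|_]; first by case/eqP: hp; rewrite pA orient_start.
  by case: eqP => [pB|//]; case/eqP: hp; rewrite pB orient_end.
have pE : p = A + (dot (B - A) (p - A) / dot (B - A) (B - A)) *: (B - A).
  by rewrite -parallel_scale // addrC subrK.
set s := _ / _ in pE.
have sE : dot (B - A) (p - A) = s * dot (B - A) (B - A) by rewrite /s divfK.
clearbody s.
have sE' : dot (A - B) (p - B) = (1 - s) * dot (B - A) (B - A).
  by rewrite [in LHS]pE /dot !coordE; ring.
have eeN : dot (A - B) (A - B) = dot (B - A) (B - A).
  by rewrite /dot !coordE; ring.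
have pA : (p == A) = (s == 0).
  by rewrite pE -subr_eq0 addrC addKr scaler_eq0 (negPf e0) orbF.
have pB : (p == B) = (s == 1).
  rewrite -[s == 1]subr_eq0 -[p == B]subr_eq0.
  have -> : p - B = (s - 1) *: (B - A).
    by apply: rV2_eq; rewrite pE !coordE; ring.
  by rewrite scaler_eq0 (negPf e0) orbF.
rewrite /half_open oBA oppr_eq0 hp eqxx /= sE sE' eeN pA pB.
rewrite !(pmulr_lge0 _ ee) !(gtr_pMl _ ee) subr_ge0.
have -> : (1 - s < 1) = (0 < s) by rewrite ltrBlDr ltrDl.
case: (ltgtP s 0) => s0; case: (ltgtP s 1) => s1 //=;
  exfalso; lra.
Qed.

(** The coefficient [g r * f (dot r p)] takes the same value at [r] and [- r],
    so that the inner points of the edge cancel and only [A] and [B] remain. *)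
Lemma sum_edge_jump (V W : seq 'rV[R]_2) A B : uniq V -> uniq W ->
  A != B -> A \in V -> B \in V -> dir A B \in W -> dir B A \in W ->
  \sum_(p <- V) \sum_(r <- W) (g r)%:~R * f (dot r p) * edge_jump A B p r =
  - edge_weight A B.
Proof.
move=> uV uW AB AV BV tW tW'.
have pick (s : seq 'rV[R]_2) x (F : 'rV[R]_2 -> rat) : uniq s -> x \in s ->
    \sum_(y <- s) F y * (y == x)%:R = F x.
  move=> us xs; rewrite (bigD1_seq x) //= eqxx mulr1 big1 ?addr0 // => y.
  by move=> /negPf ->; rewrite mulr0.
have inner p : \sum_(r <- W) (g r)%:~R * f (dot r p) * edge_jump A B p r =
    (g (dir A B))%:~R * f (dot (dir A B) p) * ((p == A)%:R - (p == B)%:R).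
  rewrite -half_open_diff // mulrBr.
  have swap (c : rat) (b h : bool) : c * (b && h)%:R = c * h%:R * b%:R.
    by case: b; case: h; rewrite /= ?mulr1 ?mulr0.
  under eq_bigr do rewrite /edge_jump mulrBr /edge_germ !(swap _ (_ == dir _ _)).
  rewrite big_split sumrN /= !pick // (dir_sym A B) gN.
  have -> : dot (- dir A B) p = - dot (dir A B) p by rewrite /dot !coordE; ring.
  by rewrite additiveN mulrNz mulrNN.
under eq_bigr do rewrite inner mulrBr.
rewrite big_split sumrN /= !pick // -mulrBr /edge_weight -mulrN; congr (_ * _).
rewrite -!additiveN -fD; congr f.
have en : 0 < enorm (B - A) by rewrite enorm_gt0 subr_eq0 eq_sym.
apply: (mulfI (lt0r_neq0 en)); rewrite mulrN -expr2 enorm_sqr.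
rewrite /dir /dot !(scalev_coord _ (B - A)) mulrDr.
rewrite !coordE; field; exact: lt0r_neq0.
Qed.

(** Weights are linear in germ counts by [germ_jump] and [sum_edge_jump], and
    germ counts are additive by [tiling_germ]. *)
Lemma quad_weight_tiling_ccw N (A B C D : 'I_N -> 'rV[R]_2) A0 B0 C0 D0 :
  ccw A0 B0 C0 D0 -> (forall j, ccw (A j) (B j) (C j) (D j)) ->
  quad_region A0 B0 C0 D0 =
    \bigcup_(j in [set: 'I_N]) quad_region (A j) (B j) (C j) (D j) ->
  (forall i j : 'I_N, i <> j ->
     interior (quad_region (A i) (B i) (C i) (D i)) `&`
     interior (quad_region (A j) (B j) (C j) (D j)) = set0) ->
  \sum_(j < N) quad_weight (A j) (B j) (C j) (D j) = quad_weight A0 B0 C0 D0.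
Proof.
move=> c0 cc cover disj.
pose corners a b c d : seq 'rV[R]_2 := [:: a; b; c; d].
pose dirs a b c d : seq 'rV[R]_2 :=
  [:: dir a b; dir b a; dir b c; dir c b; dir c d; dir d c; dir d a; dir a d].
pose V := undup (corners A0 B0 C0 D0 ++
  flatten [seq corners (A j) (B j) (C j) (D j) | j : 'I_N]).
pose W := undup (dirs A0 B0 C0 D0 ++
  flatten [seq dirs (A j) (B j) (C j) (D j) | j : 'I_N]).
have uV : uniq V by exact: undup_uniq.
have uW : uniq W by exact: undup_uniq.
pose J a b c d p r : rat := (germ_in a b c d p r (rot90 r))%:R -
  (germ_in a b c d p r (- rot90 r))%:R.
have weightE a b c d : ccw a b c d -> {subset corners a b c d <= V} ->
    {subset dirs a b c d <= W} -> quad_weight a b c d =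
    - \sum_(p <- V) \sum_(r <- W | dot r r == 1)
        (g r)%:~R * f (dot r p) * J a b c d p r.
  move=> abcd sV sW; have c2 := ccw_rot abcd; have c3 := ccw_rot c2.
  have c4 := ccw_rot c3.
  have ab := ccw_neq abcd; have bc := ccw_neq c2; have cd := ccw_neq c3.
  have da := ccw_neq c4.
  have sum a' b' : a' != b' -> a' \in V -> b' \in V -> dir a' b' \in W ->
      dir b' a' \in W -> \sum_(p <- V) \sum_(r <- W | dot r r == 1)
      (g r)%:~R * f (dot r p) * edge_jump a' b' p r = - edge_weight a' b'.
    move=> nab *; rewrite -(sum_edge_jump uV uW) //; apply: eq_bigr => p _.
    rewrite [RHS](bigID (fun r => dot r r == 1)) /= [X in _ = _ + X]big1 ?addr0 //.
    move=> r r1; rewrite /edge_jump /edge_germ.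
    have -> : (r == dir a' b') = false.
      by apply: contraNF r1 => /eqP ->; rewrite dot_dir.
    have -> : (r == dir b' a') = false.
      by apply: contraNF r1 => /eqP ->; rewrite dot_dir // eq_sym.
    by rewrite subrr mulr0.
  have {}sum a' b' : a' != b' -> a' \in V -> b' \in V -> dir a' b' \in W ->
      dir b' a' \in W -> edge_weight a' b' =
      - \sum_(p <- V) \sum_(r <- W | dot r r == 1)
      (g r)%:~R * f (dot r p) * edge_jump a' b' p r.
    by move=> *; rewrite sum // opprK.
  rewrite /quad_weight.
  rewrite (sum a b) ?sV ?sW ?(sum b c) ?(sum c d) ?(sum d a) ?sV ?sW ?inE
    ?eqxx ?orbT // -!opprD -!big_split; congr (- _); apply: eq_bigr => p _.
  rewrite -!big_split; apply: eq_bigr => r /eqP r1.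
  by rewrite /J (germ_jump _ abcd r1) !mulrDr.
have sub0 : {subset corners A0 B0 C0 D0 <= V} /\ {subset dirs A0 B0 C0 D0 <= W}.
  by split=> x xs; rewrite mem_undup mem_cat xs.
have subj j : {subset corners (A j) (B j) (C j) (D j) <= V} /\
    {subset dirs (A j) (B j) (C j) (D j) <= W}.
  by split=> x xs; rewrite mem_undup mem_cat; apply/orP; right;
    apply/flatten_imageP; exists j.
rewrite weightE //; try (by case: sub0).
under eq_bigr => j _ do rewrite (weightE _ _ _ _ (cc j) (subj j).1 (subj j).2).
rewrite sumrN exchange_big /=; congr (- _); apply: eq_bigr => p _.
rewrite exchange_big /=; apply: eq_bigr => r /eqP r1.
rewrite -mulr_sumr; congr (_ * _); rewrite /J sumrB.
have cr : cross r (rot90 r) = 1 by rewrite -r1 /cross /dot /rot90 !coordE; ring.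
have crN : cross r (- rot90 r) = - 1.
  by rewrite -r1 /cross /dot /rot90 !coordE; ring.
by rewrite !(tiling_germ _ _ c0 cc cover disj) ?cr ?crN ?oppr_eq0 ?oner_eq0.
Qed.
End Weights.
End Additivity.

(** * Rigid motions, trapezoids and rectangles *)

Section Shapes.
Variable R : realType.
Implicit Types (A B C D X Y p r t u v w x : 'rV[R]_2).

Lemma cauchy_schwarz u v : dot u v ^+ 2 <= dot u u * dot v v.
Proof.
rewrite -subr_ge0; have -> : dot u u * dot v v - dot u v ^+ 2 = cross u v ^+ 2.
  by rewrite /dot /cross; ring.
exact: sqr_ge0.
Qed.

Lemma right_angle_dot X Y Z : X != Y -> Z != Y -> angle X Y Z = pi / 2 ->
  dot (X - Y) (Z - Y) = 0.
Proof.
rewrite -!(subr_eq0 _ Y) /angle; move: (X - Y) (Z - Y) => u v u0 v0 h.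
have nu : 0 < enorm u by rewrite enorm_gt0.
have nv : 0 < enorm v by rewrite enorm_gt0.
have nuv : 0 < enorm u * enorm v by rewrite mulr_gt0.
have : `|dot u v| <= enorm u * enorm v.
  rewrite -(ler_pXn2r (n := 2)) ?nnegrE ?normr_ge0 ?(ltW nuv) //.
  by rewrite real_normK ?num_real // exprMn !enorm_sqr cauchy_schwarz.
rewrite ler_norml => /andP[h1 h2].
have x1 : dot u v / (enorm u * enorm v) \in `[-1, 1].
  rewrite in_itv /=.
  by rewrite ler_pdivlMr // ler_pdivrMr // mulN1r mul1r h1 h2.
have := acosK x1; rewrite h cos_pihalf => /esym /eqP.
by rewrite mulf_eq0 invr_eq0 (gt_eqF nuv) orbF => /eqP.
Qed.

Lemma convex_ccw A B C D :
  convex_quadrilateral A B C D -> ccw A B C D \/ ccw D C B A.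
Proof.
case=> [h|[h1 h2 h3 h4]]; [by left|right].
by split; [move: h2|move: h1|move: h4|move: h3]; rewrite /orient /cross !coordE;
  lra.
Qed.

Lemma convex_quadrilateral_neq A B C D : convex_quadrilateral A B C D ->
  [/\ A != B, B != C, C != D & D != A].
Proof.
case/convex_ccw => cc; have c2 := ccw_rot cc; have c3 := ccw_rot c2.
  by split; apply: ccw_neq; [exact: cc|exact: c2|exact: c3|exact: (ccw_rot c3)].
by split; rewrite eq_sym; apply: ccw_neq;
  [exact: c3|exact: c2|exact: cc|exact: (ccw_rot c3)].
Qed.

Lemma convex_right_angles A B C D : convex_quadrilateral A B C D ->
  [/\ angle D A B = pi / 2 -> dot (D - A) (B - A) = 0,
      angle A B C = pi / 2 -> dot (A - B) (C - B) = 0 &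
      angle B C D = pi / 2 -> dot (B - C) (D - C) = 0].
Proof.
move=> cx; have [AB BC CD DA] := convex_quadrilateral_neq cx.
by split; apply: right_angle_dot; rewrite // eq_sym.
Qed.

Lemma quad_region_rev A B C D : quad_region D C B A = quad_region A B C D.
Proof.
rewrite /quad_region; congr convex_hull; apply/seteqP.
by split=> x /= [[[->|->]|->]|->]; rewrite /setU /=; tauto.
Qed.

Lemma rigid_motion_sub (th : R) b v X Y :
  rigid_motion th b v X - rigid_motion th b v Y = rigid_motion th b 0 (X - Y).
Proof.
apply: rV2_eq; rewrite /rigid_motion /rotation /reflection; case: b;
  rewrite !coordE ?mxE; ring.
Qed.

Lemma rigid_motion_dot (th : R) b u v :
  dot (rigid_motion th b 0 u) (rigid_motion th b 0 v) = dot u v.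
Proof.
have e := cos2Dsin2 th.
transitivity ((cos th ^+ 2 + sin th ^+ 2) * dot u v); last by rewrite e mul1r.
rewrite /dot /rigid_motion /rotation /reflection; case: b;
  rewrite !coordE ?mxE; ring.
Qed.

Lemma rigid_motion_cross (th : R) b u v :
  cross (rigid_motion th b 0 u) (rigid_motion th b 0 v) =
  (if b then -1 else 1) * cross u v.
Proof.
have e := cos2Dsin2 th.
transitivity ((cos th ^+ 2 + sin th ^+ 2) * ((if b then -1 else 1) * cross u v)).
  rewrite /cross /rigid_motion /rotation /reflection; case: b;
    rewrite !coordE ?mxE; ring.
by rewrite e mul1r.
Qed.

Lemma rigid_motion_convex (th : R) b v A B C D : convex_quadrilateral A B C D ->
  convex_quadrilateral (rigid_motion th b v A) (rigid_motion th b v B)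
    (rigid_motion th b v C) (rigid_motion th b v D).
Proof.
rewrite /convex_quadrilateral /orient !rigid_motion_sub !rigid_motion_cross.
by case: b => -[] [h1 h2 h3 h4]; [right|left|left|right]; split; lra.
Qed.

Lemma image_convex_hull (M : 'rV[R]_2 -> 'rV[R]_2) (V : set 'rV[R]_2) :
  (forall (l : R) X Y, M (l *: X + (1 - l) *: Y) = l *: M X + (1 - l) *: M Y) ->
  M @` convex_hull V = convex_hull (M @` V).
Proof.
move=> affM.
have Mconv (l : {i01 R}) X Y :
  M (conv l (X : convex_lmodType 'rV[R]_2) Y) =
  conv l (M X : convex_lmodType 'rV[R]_2) (M Y) by rewrite !conv_rV2 affM.
apply/seteqP; split.
  move=> _ [X hX <-] K [cK VK].
  apply: (hX (M @^-1` K)); split=> [Y Z l|Y VY]; last by apply: VK; exists Y.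
  move=> /set_mem KY /set_mem KZ; apply/mem_set => /=.
  rewrite Mconv; apply/set_mem/cK; exact/mem_set.
apply: smallest_sub => [Y Z l|_ [X VX <-]]; last first.
  by exists X => // K [_]; exact.
move=> /set_mem[X hX <-] /set_mem[X' hX' <-]; apply/mem_set.
exists (conv l (X : convex_lmodType 'rV[R]_2) X'); last exact: Mconv.
move=> K cVK; apply/set_mem/(cVK.1 X X' l); apply/mem_set; [exact: hX|exact: hX'].
Qed.

Lemma rigid_motion_quad (th : R) b v A B C D :
  rigid_motion th b v @` quad_region A B C D =
  quad_region (rigid_motion th b v A) (rigid_motion th b v B)
    (rigid_motion th b v C) (rigid_motion th b v D).
Proof.
rewrite /quad_region image_convex_hull.
  by rewrite !image_setU !image_set1.
move=> l X Y; apply: rV2_eq; rewrite /rigid_motion /rotation /reflection;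
  case: b; rewrite !coordE ?mxE; ring.
Qed.

(** In the orthonormal frame [t], [w] given by the leg [AB] and the first base,
    the slanted side is [- (h t + d w)], where [d] is the signed difference of
    the bases. *)
Lemma trapezoid_frame A B C D (h := enorm (B - A))
    (d := enorm (C - B) - enorm (A - D)) (c := enorm (D - C)) :
  convex_quadrilateral A B C D ->
  dot (D - A) (B - A) = 0 -> dot (A - B) (C - B) = 0 ->
  exists t w, [/\ dot t t = 1, w = rot90 t \/ w = - rot90 t,
    c ^+ 2 = h ^+ 2 + d ^+ 2, dot (B - C) (D - C) = enorm (C - B) * d &
    [/\ dir A B = t, dir B C = w, dir D A = - w &
        dir C D = - (c^-1 *: (h *: t + d *: w))]].
Proof.
move=> cx rA rB.
have [AB _ _ _] := convex_quadrilateral_neq cx.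
have e0 : B - A != 0 by rewrite subr_eq0 eq_sym.
have h0 : 0 < h by rewrite enorm_gt0.
pose t := dir A B; have t1 : dot t t = 1 by rewrite dot_dir.
have eAB : B - A = h *: t by rewrite /t /dir scalerA divff ?scale1r // gt_eqF.
have perp u : dot (B - A) u = 0 -> u = dot (rot90 t) u *: rot90 t.
  rewrite eAB => tu.
  have {}tu : dot t u = 0.
    apply: (mulfI (lt0r_neq0 h0)); rewrite mulr0 -tu /dot !(scalev_coord h t).
    by ring.
  transitivity (dot t t *: u - dot t u *: t).
    by rewrite t1 tu scale1r scale0r subr0.
  by apply: rV2_eq; rewrite /rot90 /dot !coordE; ring.
pose x := dot (rot90 t) (C - B); pose y := dot (rot90 t) (D - A).
have eBC : C - B = x *: rot90 t.
  by apply: perp; rewrite -oppr0 -rB /dot !coordE; ring.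
have eAD : D - A = y *: rot90 t.
  by apply: perp; rewrite -rA /dot; ring.
have oABC : orient A B C = h * x.
  have -> : orient A B C = cross (B - A) (C - B).
    by rewrite /orient /cross !coordE; ring.
  rewrite eAB eBC -[RHS]mulr1 -t1 /cross /dot /rot90.
  by rewrite !(scalev_coord h t) !coordE; ring.
have oDAB : orient D A B = h * y.
  have -> : orient D A B = cross (B - A) (D - A).
    by rewrite /orient /cross !coordE; ring.
  rewrite eAB eAD -[RHS]mulr1 -t1 /cross /dot /rot90.
  by rewrite !(scalev_coord h t) !coordE; ring.
have [s [s2 sx sy]] : exists s : R, [/\ s = 1 \/ s = -1, 0 < s * x & 0 < s * y].
  case: cx => -[k1 _ _ k4]; move: k1 k4; rewrite oABC oDAB.
    rewrite !pmulr_rgt0 // => x0 y0; exists 1; rewrite !mul1r; split=> //.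
    by left.
  rewrite !pmulr_rlt0 // => x0 y0; exists (-1).
  by rewrite !mulN1r !oppr_gt0; split=> //; right.
have ss : s * s = 1 by case: s2 => ->; rewrite ?mulr1 ?mulrNN ?mulr1.
(* [s] is the orientation of the quadrilateral *)
pose w := s *: rot90 t.
have wE : w = rot90 t \/ w = - rot90 t.
  by rewrite /w; case: s2 => ->; [left|right]; rewrite ?scale1r ?scaleN1r.
have w1 : dot w w = 1.
  rewrite -t1 -[RHS]mul1r -ss /w /dot /rot90 !coordE; ring.
have enw (k : R) : 0 < k -> enorm (k *: w) = k.
  move=> k0; rewrite /enorm.
  have -> : dot (k *: w) (k *: w) = k ^+ 2 * dot w w.
    by rewrite /dot !(scalev_coord k w); ring.
  by rewrite w1 mulr1 sqrtr_sqr gtr0_norm.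
have wBC : C - B = (s * x) *: w.
  by rewrite /w scalerA mulrAC ss mul1r.
have wDA : D - A = (s * y) *: w.
  by rewrite /w scalerA mulrAC ss mul1r.
have lBC : enorm (C - B) = s * x by rewrite wBC enw.
have lDA : enorm (A - D) = s * y by rewrite -opprB enormN wDA enw.
have dE : d = s * x - s * y by rewrite /d lBC lDA.
have eDC : D - C = - (h *: t + d *: w).
  have -> : D - C = (D - A) - (C - B) - (B - A).
    by apply: rV2_eq; rewrite !coordE; ring.
  rewrite wBC wDA eAB dE; apply: rV2_eq; rewrite !coordE; ring.
have tw : dot t w = 0 by rewrite /w /dot /rot90 !coordE; ring.
have dirE X Y (k : R) v : 0 < k -> dot v v = 1 -> Y - X = k *: v -> dir X Y = v.
  move=> k0 v1 e; rewrite /dir e; have -> : enorm (k *: v) = k.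
    rewrite /enorm; have -> : dot (k *: v) (k *: v) = k ^+ 2 * dot v v.
      by rewrite /dot !(scalev_coord k v); ring.
    by rewrite v1 mulr1 sqrtr_sqr gtr0_norm.
  by rewrite scalerA mulVf ?scale1r // gt_eqF.
exists t, w; split=> //.
- rewrite /c enorm_sqr eDC.
  transitivity (h ^+ 2 * dot t t + 2 * h * d * dot t w + d ^+ 2 * dot w w).
    by rewrite /dot !oppv_coord !addv_coord !scalev_coord; ring.
  by rewrite t1 tw w1; ring.
- have -> : dot (B - C) (D - C) = dot ((s * x) *: w) (h *: t + d *: w).
    by rewrite -wBC eDC /dot !(coordE, coordE); ring.
  transitivity ((s * x) * (h * dot t w + d * dot w w)).
    by rewrite /dot !(scalev_coord _ w) !addv_coord !scalev_coord; ring.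
  by rewrite tw w1 lBC; ring.
split=> //; first exact: dirE wBC.
  by rewrite dir_sym (dirE A D (s * y) w).
by rewrite /dir -/c eDC scalerN.
Qed.

Section Weights.
Variables (f : R -> rat) (g : 'rV[R]_2 -> int).
Hypothesis fD : {morph f : x y / x + y}.
Hypothesis gN : forall u, g (- u) = - g u.

Lemma quad_weight_rev A B C D :
  quad_weight f g D C B A = - quad_weight f g A B C D.
Proof.
rewrite /quad_weight (edge_weight_sym f gN C D) (edge_weight_sym f gN B C).
by rewrite (edge_weight_sym f gN A B) (edge_weight_sym f gN D A); ring.
Qed.

(** Reversing the order of the vertices negates the weight, so for vertices
    listed in either order the weights add up to sign. *)
Lemma quad_weight_tiling N (A B C D : 'I_N -> 'rV[R]_2) A0 B0 C0 D0 :
  convex_quadrilateral A0 B0 C0 D0 ->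
  (forall j, convex_quadrilateral (A j) (B j) (C j) (D j)) ->
  quad_region A0 B0 C0 D0 =
    \bigcup_(j in [set: 'I_N]) quad_region (A j) (B j) (C j) (D j) ->
  (forall i j : 'I_N, i <> j ->
     interior (quad_region (A i) (B i) (C i) (D i)) `&`
     interior (quad_region (A j) (B j) (C j) (D j)) = set0) ->
  exists (b : 'I_N -> bool) (b0 : bool),
  \sum_(j < N) (-1) ^+ b j * quad_weight f g (A j) (B j) (C j) (D j) =
  (-1) ^+ b0 * quad_weight f g A0 B0 C0 D0.
Proof.
pose flip b A B C D : 'rV[R]_2 * 'rV[R]_2 * 'rV[R]_2 * 'rV[R]_2 :=
  if b then (D, C, B, A) else (A, B, C, D).
have orientable A' B' C' D' : convex_quadrilateral A' B' C' D' ->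
    exists b, let q := flip b A' B' C' D' in ccw q.1.1.1 q.1.1.2 q.1.2 q.2.
  by case/convex_ccw; [exists false|exists true].
have regionE b A' B' C' D' : let q := flip b A' B' C' D' in
    quad_region q.1.1.1 q.1.1.2 q.1.2 q.2 = quad_region A' B' C' D'.
  by case: b => //=; exact: quad_region_rev.
have weightE b A' B' C' D' : let q := flip b A' B' C' D' in
    quad_weight f g q.1.1.1 q.1.1.2 q.1.2 q.2 =
    (-1) ^+ b * quad_weight f g A' B' C' D'.
  rewrite /flip; case: b; cbv zeta; last by rewrite expr0 mul1r.
  by rewrite quad_weight_rev expr1 mulN1r.
move=> /orientable [b0 c0] cx; have {cx} := fun j => orientable _ _ _ _ (cx j).
move=> /choice [b cb]; rewrite -(regionE b0) => cover disj; exists b, b0.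
rewrite -weightE; under eq_bigr do rewrite -weightE.
apply: quad_weight_tiling_ccw => //.
  by rewrite cover; apply: eq_bigcupr => j _; rewrite regionE.
by move=> i j ij; rewrite !regionE; exact: disj.
Qed.

(** The bases have opposite directions, so by additivity of [f] they enter only
    through their difference. *)
Lemma trapezoid_weight A B C D (h := enorm (B - A))
    (d := enorm (C - B) - enorm (A - D)) (c := enorm (D - C)) :
  convex_quadrilateral A B C D ->
  dot (D - A) (B - A) = 0 -> dot (A - B) (C - B) = 0 ->
  exists t w, [/\ dot t t = 1, w = rot90 t \/ w = - rot90 t &
    quad_weight f g A B C D = (g t)%:~R * f h + (g w)%:~R * f d
      - (g (c^-1 *: (h *: t + d *: w)))%:~R * f c].
Proof.
move=> cx rA rB.
have [t [w [t1 wE _ _ [tAB wBC wDA uCD]]]] := trapezoid_frame cx rA rB.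
exists t, w; split=> //; rewrite /quad_weight /edge_weight tAB wBC wDA uCD.
by rewrite !gN /d fD additiveN // !mulrNz -/h -/c; ring.
Qed.
End Weights.
End Shapes.

(** * Rational functionals on the reals *)

Section Functional.
Variable R : realType.

(** Among the subsets of the reals closed under rational combinations for
    which [y] stays outside the sum with [Q x], take a maximal one [M]. It
    contains [x] and has codimension one, so every [z] is [q y] modulo [M] for a
    unique rational [q], and [f z] is that [q]. The empty set is not excluded,
    so that the union of the empty chain qualifies in Zorn's lemma. *)
Lemma rational_functional (x y : R) : (forall q : rat, y <> ratr q * x) ->
  exists f : R -> rat, [/\ {morph f : a b / a + b},
    forall q a, f (ratr q * a) = q * f a, f x = 0 & f y = 1].
Proof.
move=> yx.
pose avoiding (M : set R) := [/\ forall a b, M a -> M b -> M (a + b),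
  forall q a, M a -> M (ratr q * a) & forall q a, M a -> y <> a + ratr q * x].
have [M [[MD MZ My] Mmax]] : exists M, avoiding M /\
    forall K, M `<` K -> ~ avoiding K.
  apply: Zorn_bigcup => F FP Ftot; split.
  - move=> a b [A FA Aa] [B FB Bb].
    have [AB|BA] := Ftot _ _ FA FB.
      by exists B => //; have [BD _ _] := FP _ FB; apply: BD => //; exact: AB.
    by exists A => //; have [AD _ _] := FP _ FA; apply: AD => //; exact: BA.
  - by move=> q a [A FA Aa]; exists A => //; have [_ AZ _] := FP _ FA; exact: AZ.
  - by move=> q a [A FA Aa]; have [_ _ Ay] := FP _ FA; exact: Ay.
(* by maximality, adjoining [z] to [M] brings [y] into [M + Q z + Q x] *)
have adjoin z : ~ M z -> exists q q' m, (M m \/ m = 0) /\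
    y = m + ratr q * z + ratr q' * x.
  move=> Mz; apply: contrapT => noy.
  pose K := [set k | exists q m, (M m \/ m = 0) /\ k = m + ratr q * z].
  apply: (Mmax K).
    split=> [m Mm|KM].
      by exists 0, m; split; [left|rewrite rmorph0 mul0r addr0].
    apply/Mz/KM; exists 1, 0; split; first by right.
    by rewrite rmorph1 mul1r add0r.
  split.
  - move=> a b [q [m [Mm ->]]] [q' [m' [Mm' ->]]]; exists (q + q'), (m + m').
    split; last by rewrite rmorphD /=; ring.
    case: Mm Mm' => [Mm|->] [Mm'|->]; rewrite ?add0r ?addr0; try by [left|right].
    by left; exact: MD.
  - move=> q a [q' [m [Mm ->]]]; exists (q * q'), (ratr q * m).
    split; last by rewrite rmorphM /=; ring.
    by case: Mm => [Mm|->]; [left; exact: MZ|right; rewrite mulr0].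
  - move=> q a [q' [m [Mm ->]]] yE; apply: noy; exists q', q, m; split=> //.
have Mx : M x.
  apply: contrapT => /adjoin [q [q' [m [Mm yE]]]].
  case: Mm yE => [Mm|->] yE.
    by apply: (My (q + q') _ Mm); rewrite yE rmorphD /=; ring.
  by apply: (yx (q + q')); rewrite yE rmorphD /=; ring.
have M0 : M 0 by have := MZ 0 _ Mx; rewrite rmorph0 mul0r.
have MN a : M a -> M (- a).
  by move=> /(MZ (-1)); rewrite rmorphN rmorph1 mulN1r.
have Ny : ~ M y by move=> /(My 0); apply; rewrite rmorph0 mul0r addr0.
have coef z : exists q, M (z - ratr q * y).
  have [Mz|Mz] := pselect (M z); first by exists 0; rewrite rmorph0 mul0r subr0.
  have [q [q' [m [Mm yE]]]] := adjoin _ Mz.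
  have {}Mm : M m by case: Mm => [//|->].
  have q0 : q != 0.
    apply/eqP => q0; apply: Ny; rewrite yE q0 rmorph0 mul0r addr0.
    by apply: MD => //; exact: MZ.
  exists q^-1; have rq0 : ratr q != 0 :> R by rewrite fmorph_eq0.
  have -> : z - ratr q^-1 * y = - (ratr q^-1 * (m + ratr q' * x)).
    by rewrite yE fmorphV; field.
  by apply/MN/MZ/MD => //; exact: MZ.
have [f fP] := choice coef.
have fE z q : M (z - ratr q * y) -> f z = q.
  move=> h; have [//|fq] := eqVneq (f z) q; case: Ny.
  have := MZ (f z - q)^-1 _ (MD _ _ h (MN _ (fP z))).
  have rd : ratr (f z) - ratr q != 0 :> R.
    by rewrite -rmorphB fmorph_eq0 subr_eq0.
  have -> // : ratr (f z - q)^-1 *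
      (z - ratr q * y + - (z - ratr (f z) * y)) = y.
  by rewrite fmorphV rmorphB /=; field.
exists f; split.
- move=> a b; apply: fE; rewrite rmorphD /=.
  have -> : a + b - (ratr (f a) + ratr (f b)) * y =
    (a - ratr (f a) * y) + (b - ratr (f b) * y) by ring.
  by apply: MD; exact: fP.
- move=> q a; apply: fE; rewrite rmorphM /=.
  have -> : ratr q * a - ratr q * ratr (f a) * y =
    ratr q * (a - ratr (f a) * y) by ring.
  exact/MZ/fP.
- by apply: fE; rewrite rmorph0 mul0r subr0.
- by apply: fE; rewrite rmorph1 mul1r subrr.
Qed.
End Functional.

(** * Integers modulo 2 *)

Section Parity.

Lemma F2_cases (x : 'F_2) : x = 0 \/ x = 1.
Proof. by case: x => -[|[|//]] i; [left|right]; exact: val_inj. Qed.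

Lemma int_parity (z : int) :
  (exists2 k, z = 2 * k & z%:~R = 0 :> 'F_2) \/
  (exists2 k, z = 2 * k + 1 & z%:~R = 1 :> 'F_2).
Proof.
have F20 : (2 : int)%:~R = 0 :> 'F_2 by exact: val_inj.
have zE := divz_eq z 2; set k := (z %/ 2)%Z in zE.
have r0 : (0 <= z %% 2)%Z by rewrite modz_ge0.
have r2 : (z %% 2)%Z < 2 by rewrite ltz_pmod.
have [r|r] : (z %% 2 = 0)%Z \/ (z %% 2 = 1)%Z by lia.
  left; exists k; first by rewrite {1}zE r addr0 mulrC.
  by rewrite zE r addr0 rmorphM /= F20 mulr0.
right; exists k; first by rewrite {1}zE r mulrC.
by rewrite zE r rmorphD rmorphM /= F20 mulr0 add0r.
Qed.

Lemma natr_F2_eq0 (n : nat) : n%:R = 0 :> 'F_2 -> ~~ odd n.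
Proof.
move=> n0; have ch : 2%N \in [pchar 'F_2] by exact: pchar_Fp.
by rewrite -dvdn2 (dvdn_pcharf ch) n0.
Qed.

Lemma primitive_triple (x y z : int) : z != 0 -> exists k x' y' z' : int,
  [/\ k != 0, x = k * x', y = k * y', z = k * z' &
    ~ [/\ x'%:~R = 0 :> 'F_2, y'%:~R = 0 :> 'F_2 & z'%:~R = 0 :> 'F_2]].
Proof.
move=> z0; pose k := gcdz (gcdz x y) z.
have k0 : k != 0 by rewrite gcdz_eq0 negb_and z0 orbT.
have kz : (k %| z)%Z by exact: dvdz_gcdr.
have kx : (k %| x)%Z by apply: dvdz_trans (dvdz_gcdl _ _) (dvdz_gcdl _ _).
have ky : (k %| y)%Z by apply: dvdz_trans (dvdz_gcdl _ _) (dvdz_gcdr _ _).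
have E u : (k %| u)%Z -> u = k * (u %/ k)%Z by move=> /divzK {1}<-; rewrite mulrC.
exists k, (x %/ k)%Z, (y %/ k)%Z, (z %/ k)%Z; split=> //; try exact: E.
move=> [ex ey ez].
have dbl u : (k %| u)%Z -> (u %/ k)%Z%:~R = 0 :> 'F_2 -> (2 * k %| u)%Z.
  move=> ku; case: (int_parity (u %/ k)%Z) => -[a uE] -> //.
  by move=> _; rewrite (E u ku) uE; apply/dvdzP; exists a; ring.
have : (2 * k %| k)%Z by rewrite /k !dvdz_gcd -/k !dbl.
move=> /dvdzP[a aE]; have : k * (2 * a - 1) = 0.
  by transitivity (a * (2 * k) - k); [ring|rewrite -aE subrr].
by move/eqP; rewrite mulf_eq0 (negPf k0) /= => /eqP; lia.
Qed.

(** A sum of two odd squares is 2 modulo 4, hence not a square; so in a triple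
    without common factor 2 exactly one leg is even. *)
Lemma pythagorean_parity (x y z : int) : x ^+ 2 + y ^+ 2 = z ^+ 2 ->
  ~ [/\ x%:~R = 0 :> 'F_2, y%:~R = 0 :> 'F_2 & z%:~R = 0 :> 'F_2] ->
  z%:~R = 1 :> 'F_2 /\
  ((x%:~R = 1 :> 'F_2 /\ y%:~R = 0 :> 'F_2) \/
   (x%:~R = 0 :> 'F_2 /\ y%:~R = 1 :> 'F_2)).
Proof.
move=> xyz prim.
case: (int_parity x) => -[a xE x2]; case: (int_parity y) => -[b yE y2];
  case: (int_parity z) => -[k zE z2]; rewrite ?x2 ?y2 ?z2; try by [|split; auto].
all: try by case: prim.
all: by exfalso; move: xyz; rewrite xE yE zE !expr2; lia.
Qed.

End Parity.

(** * Colourings of directions *)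

Section Colourings.
Variable R : realType.
Implicit Types (t u v w : 'rV[R]_2).

(** An odd function, equal to 1 or -1 off the origin: its values are odd and
    serve to turn a colouring of lines through the origin into an odd weight. *)
Definition lexsign u : int :=
  if (0 < u 0 0) || ((u 0 0 == 0) && (0 < u 0 1)) then 1
  else if u == 0 then 0 else -1.

Lemma lexsignN u : lexsign (- u) = - lexsign u.
Proof.
have [->|u0] := eqVneq u 0; first by rewrite oppr0 /lexsign !mxE ltxx !eqxx.
have u01 : (u 0 0 != 0) || (u 0 1 != 0).
  rewrite -negb_and; apply: contra u0 => /andP[/eqP a /eqP b].
  by apply/eqP/rV2_eq; rewrite ?a ?b mxE.
rewrite /lexsign !oppv_coord !oppr_gt0 !oppr_eq0 (negPf u0); move: u01.
by case: (ltgtP (u 0 0) 0) => //=; case: (ltgtP (u 0 1) 0).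
Qed.

Lemma lexsign_odd u : u != 0 -> (lexsign u)%:~R = 1 :> 'F_2.
Proof.
by rewrite /lexsign => /negPf ->; case: ifP => _; apply: val_inj.
Qed.

Lemma colouring_weight (chi : 'rV[R]_2 -> bool) :
  (forall u, u != 0 -> chi (- u) = chi u) ->
  exists g : 'rV[R]_2 -> int, (forall u, g (- u) = - g u) /\
    forall u, u != 0 -> (g u)%:~R = (chi u)%:R :> 'F_2.
Proof.
move=> chiN; exists (fun u => if chi u then lexsign u else 0); split=> u.
  have [->|u0] := eqVneq u 0.
    by rewrite oppr0 /lexsign !mxE !ltxx !eqxx /=; case: ifP.
  by rewrite chiN // lexsignN; case: ifP; rewrite ?oppr0.
by move=> u0; case: ifP => // _; rewrite lexsign_odd.
Qed.

(** The open first and third quadrants with the horizontal axis: a quarter turn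
    exchanges this set with its complement. *)
Definition quadrant u : bool := (0 < u 0 0 * u 0 1) || (u 0 1 == 0).

Lemma quadrantN u : quadrant (- u) = quadrant u.
Proof. by rewrite /quadrant !oppv_coord mulrNN oppr_eq0. Qed.

Lemma quadrant_rot90 u : u != 0 -> quadrant (rot90 u) = ~~ quadrant u.
Proof.
move=> u0; have u01 : (u 0 0 != 0) || (u 0 1 != 0).
  rewrite -negb_and; apply: contra u0 => /andP[/eqP a /eqP b].
  by apply/eqP/rV2_eq; rewrite ?a ?b mxE.
rewrite /quadrant /rot90 !coordE mulNr oppr_gt0 [u 0 1 * _]mulrC; move: u01.
case: (ltgtP (u 0 0) 0) => a; case: (ltgtP (u 0 1) 0) => b //= _;
  rewrite ?a ?b ?mulr0 ?mul0r ?ltxx //.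
all: have : u 0 0 * u 0 1 != 0 by rewrite mulf_neq0 ?neq_lt ?a ?b ?orbT.
all: by case: ltgtP.
Qed.

(** Two vectors are related when the tangent of the angle between their lines is
    [e * y / x] with [x] odd. Since [e] is even, tangents of this form are closed
    under the addition formula, and the parity [b] of [y] is additive. *)
Section SmallTurns.
Variable e : int.
Hypotheses (e0 : e != 0) (e2 : e%:~R = 0 :> 'F_2).

Definition small_turn u v (b : 'F_2) : Prop := exists (l : R) (x y : int),
  [/\ l != 0, x%:~R = 1 :> 'F_2, y%:~R = b &
      v = l *: (x%:~R *: u + (e * y)%:~R *: rot90 u)].

Lemma odd_neq0 (x : int) : x%:~R = 1 :> 'F_2 -> x%:~R != 0 :> R.
Proof. by move=> x1; rewrite intr_eq0; apply: contra_eq_neq x1 => ->. Qed.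

Lemma small_turn_refl u : small_turn u u 0.
Proof.
exists 1, 1, 0; split; rewrite ?oner_neq0 //.
by rewrite mulr0 scale0r addr0 !scale1r.
Qed.

Lemma small_turn_trans v u w b c :
  small_turn u v b -> small_turn v w c -> small_turn u w (b + c).
Proof.
move=> [l [x [y [l0 x1 yb ->]]]] [l' [x' [y' [l0' x1' yc ->]]]].
exists (l * l'), (x * x' - e ^+ 2 * y * y'), (x * y' + y * x').
split; first by rewrite mulf_neq0.
- by rewrite expr2 rmorphB !rmorphM /= e2 x1 x1' !mul0r subr0 mulr1.
- by rewrite rmorphD !rmorphM /= x1 x1' yb yc mul1r mulr1 addrC.
rewrite !(rmorphB, rmorphD, rmorphM, rmorphXn) /=.
by apply: rV2_eq; rewrite /rot90 !coordE; ring.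
Qed.

Lemma small_turn_sym u v b : small_turn u v b -> small_turn v u b.
Proof.
move=> [l [x [y [l0 x1 yb ->]]]].
have x0 := odd_neq0 x1.
have n0 : x%:~R ^+ 2 + (e * y)%:~R ^+ 2 != 0 :> R.
  by rewrite paddr_eq0 ?sqr_ge0 // !sqrf_eq0 (negPf x0).
exists (l * (x%:~R ^+ 2 + (e * y)%:~R ^+ 2))^-1, x, (- y); split=> //.
- by rewrite invr_eq0 mulf_neq0.
- by rewrite mulrNz yb; case: (F2_cases b) => ->; apply: val_inj.
rewrite mulrN mulrNz; move: x%:~R (e * y)%:~R n0 => X Y n0.
by apply: rV2_eq; rewrite /rot90 !coordE; field; rewrite n0 l0.
Qed.

Lemma small_turn_unique u v b c : u != 0 ->
  small_turn u v b -> small_turn u v c -> b = c.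
Proof.
move=> u0 [l [x [y [l0 x1 yb ->]]]] [l' [x' [y' [l0' x1' yc]]]] uv.
have uu : dot u u != 0 by rewrite dot_eq0.
have hx : l * x%:~R = l' * x'%:~R.
  apply: (mulIf uu); transitivity
    (dot u (l *: (x%:~R *: u + (e * y)%:~R *: rot90 u))).
    by rewrite /dot /rot90 !coordE; ring.
  by rewrite uv /dot /rot90 !coordE; ring.
have hy : l * (e * y)%:~R = l' * (e * y')%:~R.
  apply: (mulIf uu); transitivity
    (cross u (l *: (x%:~R *: u + (e * y)%:~R *: rot90 u))).
    by rewrite /cross /dot /rot90 !coordE; ring.
  by rewrite uv /cross /dot /rot90 !coordE; ring.
have : (y * x')%:~R = (y' * x)%:~R :> R.
  have e0R : e%:~R != 0 :> R by rewrite intr_eq0.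
  apply: (mulfI (mulf_neq0 (mulf_neq0 l0 l0') e0R)).
  transitivity (l * (e * y)%:~R * (l' * x'%:~R)).
    by rewrite !rmorphM /=; ring.
  by rewrite hy -hx !rmorphM /=; ring.
move=> /intr_inj /(congr1 (fun z : int => z%:~R : 'F_2)).
by rewrite !rmorphM /= x1 x1' !mulr1 yb yc.
Qed.

(** In each class of the relation choose a representative and colour a vector
    by the parity of its turn from there: turns with [y = 1] or [y = -1] change
    the colour. *)
Lemma small_turn_colouring : exists chi : 'rV[R]_2 -> bool,
  (forall u, u != 0 -> chi (- u) = chi u) /\
  (forall u l (x y : int), u != 0 -> l != 0 -> x%:~R = 1 :> 'F_2 ->
    y = 1 \/ y = -1 ->
    chi (l *: (x%:~R *: u + (e * y)%:~R *: rot90 u)) = ~~ chi u).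
Proof.
pose cls u : set 'rV[R]_2 := [set v | exists b, small_turn v u b].
pose rep u := xget 0 (cls u).
have repP u : cls u (rep u).
  by apply: (@xgetPex _ 0 (cls u)); exists u, 0; exact: small_turn_refl.
have rep_neq0 u : u != 0 -> rep u != 0.
  move=> u0; have [b [l [x [y [_ _ _ uE]]]]] := repP u.
  apply: contra_neq u0 => r0; rewrite uE r0.
  by apply: rV2_eq; rewrite /rot90 !coordE !mxE; ring.
have rep_eq u v b : small_turn u v b -> rep v = rep u.
  move=> uv; congr (xget 0 _); apply/seteqP; split=> z [c h].
    by exists (c + b); apply: small_turn_trans h _; exact: small_turn_sym.
  by exists (c + b); apply: small_turn_trans h uv.
exists (fun u => `[< small_turn (rep u) u 1 >]).
have chiE u v b c : u != 0 -> small_turn u v b -> small_turn (rep u) u c ->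
    `[< small_turn (rep v) v 1 >] = (c + b == 1).
  move=> u0 uv ru; rewrite (rep_eq _ _ _ uv); apply/asboolP/eqP => [h|<-].
    apply: (small_turn_unique (rep_neq0 _ u0)) h.
    exact: small_turn_trans ru uv.
  exact: small_turn_trans ru uv.
split=> [u u0|u l x y u0 l0 x1 y1]; have [c hc] := repP u.
  rewrite (chiE u u 0 c) ?(chiE u (- u) 0 c) //; last exact: small_turn_refl.
  exists (-1), 1, 0; split; rewrite ?oppr_eq0 ?oner_neq0 //.
  by rewrite mulr0 scale0r addr0 scale1r scaleN1r.
rewrite (chiE u _ 1 c) // ?(chiE u u 0 c) //; last first.
- by exists l, x, y; split=> //; case: y1 => ->; apply: val_inj.
- exact: small_turn_refl.
by case: (F2_cases c) => ->.
Qed.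
End SmallTurns.
End Colourings.

(** * Weights that are odd on every tile *)

Section ParityWeights.
Variable R : realType.
Implicit Types (t u v w : 'rV[R]_2).

(** [odd_bracket] says that the weight of a trapezoid in the frame [t], [w] is an
    odd integer when the functional takes the values [fh], [fd], [fc] at [h],
    [d], [c]. *)
Definition odd_bracket (h d c : R) (g : 'rV[R]_2 -> int) (fh fd fc : int) :=
  forall t w, dot t t = 1 -> w = rot90 t \/ w = - rot90 t ->
  (g t * fh + g w * fd - g (c^-1 *: (h *: t + d *: w)) * fc)%:~R = 1 :> 'F_2.

Definition odd_function (g : 'rV[R]_2 -> int) := forall u, g (- u) = - g u.

Lemma dot1_neq0 u : dot u u = 1 -> u != 0.
Proof. by move=> u1; rewrite -dot_eq0 u1 oner_neq0. Qed.

Lemma rot90_neq0 u : u != 0 -> rot90 u != 0.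
Proof.
move=> u0; rewrite -dot_eq0; have -> : dot (rot90 u) (rot90 u) = dot u u.
  by rewrite /dot /rot90 !coordE; ring.
by rewrite dot_eq0.
Qed.

(** If the slanted side is invisible to the functional, only the perpendicular
    directions [t] and [w] matter. With one odd coefficient every direction may
    weigh 1; with two, exactly one of [t] and [w] should. *)
Lemma odd_bracket_legs (h d c : R) (fh fd : int) :
  ~ (fh%:~R = 0 :> 'F_2 /\ fd%:~R = 0 :> 'F_2) ->
  exists2 g, odd_function g & odd_bracket h d c g fh fd 0.
Proof.
move=> nz.
suff [chi [chiN chiP]] : exists chi : 'rV[R]_2 -> bool,
    (forall u, u != 0 -> chi (- u) = chi u) /\
    forall t, t != 0 ->
      (chi t)%:R * fh%:~R + (chi (rot90 t))%:R * fd%:~R = 1 :> 'F_2.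
  have [g [gN gP]] := colouring_weight chiN; exists g => // t w t1 wE.
  have t0 := dot1_neq0 t1; have r0 := rot90_neq0 t0.
  rewrite mulr0 subr0 rmorphD !rmorphM /= gP //.
  by case: wE => ->; rewrite gP ?oppr_eq0 // ?chiN //; exact: chiP.
have [e2|e2] := F2_cases fh%:~R; have [e2'|e2'] := F2_cases fd%:~R.
- by case: nz.
- by exists xpredT; split=> // t _; rewrite e2 e2'; apply: val_inj.
- by exists xpredT; split=> // t _; rewrite e2 e2'; apply: val_inj.
exists (@quadrant R); split=> [u _|t t0]; first exact: quadrantN.
by rewrite quadrant_rot90 // e2 e2'; case: quadrant; apply: val_inj.
Qed.

(** Here the slanted side and one leg have odd coefficients while the other leg
    has an even one. The slanted side makes with the odd leg an angle whose
    tangent is the quotient of the even coefficient by the odd one, so that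
    [small_turn_colouring] gives them different colours. *)
Lemma odd_bracket_pythagorean (h d c : R) (fh fd fc : int) :
  h != 0 -> d != 0 -> c != 0 ->
  h * fc%:~R = c * fh%:~R -> d * fc%:~R = c * fd%:~R -> fc != 0 ->
  fh ^+ 2 + fd ^+ 2 = fc ^+ 2 ->
  ~ [/\ fh%:~R = 0 :> 'F_2, fd%:~R = 0 :> 'F_2 & fc%:~R = 0 :> 'F_2] ->
  exists2 g, odd_function g & odd_bracket h d c g fh fd fc.
Proof.
move=> h0 d0 c0 hE dE fc0 pyth prim.
have [c1 hd] := pythagorean_parity pyth prim.
have fcR : fc%:~R != 0 :> R by rewrite intr_eq0.
have fhR : fh%:~R = fc%:~R * h / c by rewrite [_ * h]mulrC hE mulrC mulKf.
have fdR : fd%:~R = fc%:~R * d / c by rewrite [_ * d]mulrC dE mulrC mulKf.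
have fh0 : fh != 0 by rewrite -(intr_eq0 R) fhR !mulf_neq0 ?invr_eq0.
have fd0 : fd != 0 by rewrite -(intr_eq0 R) fdR !mulf_neq0 ?invr_eq0.
have rot2 u : rot90 (rot90 u) = - u.
  by apply: rV2_eq; rewrite /rot90 !coordE.
have rotN u : rot90 (- u) = - rot90 u.
  by apply: rV2_eq; rewrite /rot90 !coordE.
have fcV0 : fc%:~R^-1 != 0 :> R by rewrite invr_eq0.
have slant t w : c^-1 *: (h *: t + d *: w) =
    fc%:~R^-1 *: (fh%:~R *: t + fd%:~R *: w).
  by rewrite fhR fdR; apply: rV2_eq; rewrite !coordE; field; rewrite c0 fcR.
have slant0 t w : dot t t = 1 -> w = rot90 t \/ w = - rot90 t ->
    c^-1 *: (h *: t + d *: w) != 0.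
  move=> t1 wE; have tw : dot t w = 0.
    by case: wE => ->; rewrite /dot /rot90 !coordE; ring.
  have : dot t (c^-1 *: (h *: t + d *: w)) = c^-1 * h.
    transitivity (c^-1 * (h * dot t t + d * dot t w)).
      by rewrite /dot !(coordE, coordE); ring.
    by rewrite t1 tw mulr1 mulr0 addr0.
  apply: contra_eq_neq => ->; rewrite /dot !mxE !mulr0 addr0 eq_sym.
  by rewrite mulf_neq0 // invr_eq0.
case: hd => -[h2 d2].
  have [chi [chiN chiP]] := small_turn_colouring R fd0 d2.
  have [g [gN gP]] := colouring_weight chiN; exists g => // t w t1 wE.
  have t0 := dot1_neq0 t1; have := slant0 t w t1 wE; rewrite slant.
  have [y [yE ->]] : exists y : int, (y = 1 \/ y = -1) /\ fd%:~R *: w =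
      (fd * y)%:~R *: rot90 t.
    case: wE => ->; [exists 1|exists (-1)]; rewrite ?mulr1 ?mulrN1 ?mulrNz;
      by rewrite ?scaleNr ?scalerN; auto.
  have := chiP t _ fh y t0 fcV0 h2 yE; move: (fc%:~R^-1 *: _) => s sE s0.
  rewrite rmorphB rmorphD !rmorphM /= h2 d2 c1 mulr0 addr0 !mulr1 !gP // sE.
  by case: (chi t); apply: val_inj.
have [chi [chiN chiP]] := small_turn_colouring R fh0 h2.
have [g [gN gP]] := colouring_weight chiN; exists g => // t w t1 wE.
have t0 := dot1_neq0 t1; have := slant0 t w t1 wE; rewrite slant.
have w0 : w != 0.
  by case: wE => ->; rewrite ?oppr_eq0; exact: rot90_neq0.
have [y [yE ->]] : exists y : int, (y = 1 \/ y = -1) /\ fh%:~R *: t =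
    (fh * y)%:~R *: rot90 w.
  case: wE => ->; [exists (-1)|exists 1]; rewrite ?mulr1 ?mulrN1 ?mulrNz;
    by rewrite ?rotN rot2 ?scaleNr ?scalerN ?opprK; auto.
rewrite [_ *: rot90 w + _]addrC.
have := chiP w _ fd y w0 fcV0 d2 yE; move: (fc%:~R^-1 *: _) => s sE s0.
rewrite rmorphB rmorphD !rmorphM /= h2 d2 c1 mulr0 add0r !mulr1 !gP // sE.
by case: (chi w); apply: val_inj.
Qed.

Lemma rat_odd_fraction (q : rat) : exists x y : int,
  y%:~R * q = x%:~R /\ ~ (x%:~R = 0 :> 'F_2 /\ y%:~R = 0 :> 'F_2).
Proof.
exists (numq q), (denq q); split.
  by rewrite -{2}[q]divq_num_den mulrC divfK // intr_eq0 denq_neq0.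
have := coprime_num_den q.
case: (int_parity (numq q)) => -[a -> ->]; case: (int_parity (denq q)) => -[b -> ->];
  rewrite ?abszM; try by move=> _ [].
by rewrite coprimeMl coprimeMr.
Qed.

Lemma rat_common_denominator (a b : rat) : exists x y z : int,
  [/\ z != 0, z%:~R * a = x%:~R, z%:~R * b = y%:~R &
    ~ [/\ x%:~R = 0 :> 'F_2, y%:~R = 0 :> 'F_2 & z%:~R = 0 :> 'F_2]].
Proof.
have da : (denq a)%:~R != 0 :> rat by rewrite intr_eq0 denq_neq0.
have db : (denq b)%:~R != 0 :> rat by rewrite intr_eq0 denq_neq0.
have dab := mulf_neq0 (denq_neq0 a) (denq_neq0 b).
have [k [x [y [z [k0 xE yE zE prim]]]]] :=
  primitive_triple (numq a * denq b) (numq b * denq a) dab.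
have kq : k%:~R != 0 :> rat by rewrite intr_eq0.
exists x, y, z; split=> //.
- by apply: contraTneq dab => z0; rewrite zE z0 mulr0 eqxx.
- apply: (mulfI kq); rewrite mulrA -!intrM -xE -zE !intrM -{2}[a]divq_num_den.
  by field.
- apply: (mulfI kq); rewrite mulrA -!intrM -yE -zE !intrM -{2}[b]divq_num_den.
  by field.
Qed.

Definition tile_functional (h d c : R) :=
  exists (f : R -> rat) (g : 'rV[R]_2 -> int) (fh fd fc : int),
  [/\ {morph f : x y / x + y}, odd_function g,
      [/\ f h = fh%:~R, f d = fd%:~R & f c = fc%:~R] &
      odd_bracket h d c g fh fd fc].

(** If [h] or [d] is not a rational multiple of [c], a functional vanishes at [c]
    but not at that leg. Otherwise any functional that is 1 at [c] maps the three
    lengths to a rational right triangle, which is cleared of denominators and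
    of its factors 2. *)
Lemma tile_functional_exists (h d c : R) :
  h != 0 -> d != 0 -> c != 0 -> c ^+ 2 = h ^+ 2 + d ^+ 2 ->
  tile_functional h d c.
Proof.
move=> h0 d0 c0 pyth.
have [[a hE]|hN] := pselect (exists a : rat, h = ratr a * c); last first.
  have [|f [fD fZ fc fh]] := @rational_functional R c h.
    by move=> q hq; apply: hN; exists q.
  have [x [y [yx nz]]] := rat_odd_fraction (f d).
  have [|g gN gP] := @odd_bracket_legs h d c y x; first by case=> *; case: nz.
  exists (fun z => y%:~R * f z), g, y, x, 0; split=> //.
    by move=> u v /=; rewrite fD mulrDr.
  by rewrite fh fc mulr1 mulr0.
have [[b dE]|dN] := pselect (exists b : rat, d = ratr b * c); last first.
  have [|f [fD fZ fc fd]] := @rational_functional R c d.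
    by move=> q dq; apply: dN; exists q.
  have [x [y [yx nz]]] := rat_odd_fraction (f h).
  have [|g gN gP] := @odd_bracket_legs h d c x y; first by case=> *; case: nz.
  exists (fun z => y%:~R * f z), g, x, y, 0; split=> //.
    by move=> u v /=; rewrite fD mulrDr.
  by rewrite fd fc mulr1 mulr0.
have [|f [fD fZ _ fc]] := @rational_functional R 0 c.
  by move=> q /eqP; rewrite mulr0 (negPf c0).
have [x [y [z [z0 zx zy prim]]]] := rat_common_denominator a b.
have ab1 : a ^+ 2 + b ^+ 2 = 1.
  have c20 : c ^+ 2 != 0 by rewrite expf_neq0.
  apply: (fmorph_inj (@ratr R)); apply: (mulIf c20).
  rewrite rmorph1 mul1r {2}pyth hE dE rmorphD !rmorphXn /=; ring.
have [|||g gN gP] := @odd_bracket_pythagorean h d c x y z h0 d0 c0 _ _ z0 _ prim.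
- by rewrite -(ratr_int R x) -zx rmorphM /= ratr_int hE; ring.
- by rewrite -(ratr_int R y) -zy rmorphM /= ratr_int dE; ring.
- apply: (@intr_inj rat); rewrite rmorphD !rmorphXn /= -zx -zy !exprMn.
  by rewrite -mulrDr ab1 mulr1.
exists (fun r => z%:~R * f r), g, x, y, z; split=> //.
  by move=> u v /=; rewrite fD mulrDr.
by rewrite hE dE !fZ fc !mulr1.
Qed.
End ParityWeights.

(** * Parity of the number of tiles *)

Unset Implicit Arguments.

Theorem theorem1p2 (R : realType) (P Omega : set 'rV[R]_2) (N : nat)
    (T : 'I_N -> set 'rV[R]_2) :
  right_angle_trapezoid P ->
  square Omega ->
  Omega = \bigcup_(j in [set: 'I_N]) T j ->
  (forall i j : 'I_N, i <> j -> interior (T i) `&` interior (T j) = set0) ->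
  (forall j : 'I_N, congruent (T j) P) ->
  ~~ odd N.
Proof.
move=> [A [B [C [D [alpha [alpha_lt trapP PE [angA angB] [angC _]]]]]]].
move=> [A0 [B0 [C0 [D0 [cx0 OmegaE _ [angA0 angB0 angC0 _]]]]]] cover disj congr.
have cx := trapP.1.
have [/(_ angA) rA /(_ angB) rB _] := convex_right_angles cx.
have [/(_ angA0) rA0 /(_ angB0) rB0 /(_ angC0) rC0] := convex_right_angles cx0.
have [n1 n2 n3 n4] := convex_quadrilateral_neq cx.
pose h := enorm (B - A); pose d := enorm (C - B) - enorm (A - D).
pose c := enorm (D - C).
have h0 : h != 0 by rewrite gt_eqF // enorm_gt0 subr_eq0 eq_sym.
have c0 : c != 0 by rewrite gt_eqF // enorm_gt0 subr_eq0 eq_sym.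
have [_ [_ [_ _ pyth rC _]]] := trapezoid_frame cx rA rB.
(* equal bases would make the angle at [C] right *)
have d0 : d != 0.
  apply: contraTneq alpha_lt => d0; rewrite -angC /angle rC -/d d0 mulr0 mul0r.
  by rewrite acos0 ltxx andbF.
have [f [g [fh [fd [fc [fD gN [fhE fdE fcE] oddP]]]]]] :=
  tile_functional_exists h0 d0 c0 pyth.
have [th /choice [b /choice [v TE]]] := choice congr.
pose M j := rigid_motion (th j) (b j) (v j).
have TE' j : T j = quad_region (M j A) (M j B) (M j C) (M j D).
  by rewrite TE PE rigid_motion_quad.
have cxT j : convex_quadrilateral (M j A) (M j B) (M j C) (M j D).
  exact: rigid_motion_convex.
have [e [e0 sumE]] : exists (e : 'I_N -> bool) (e0 : bool),
  \sum_(j < N) (-1) ^+ e j * quad_weight f g (M j A) (M j B) (M j C) (M j D) =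
  (-1) ^+ e0 * quad_weight f g A0 B0 C0 D0.
  apply: quad_weight_tiling => //.
    by rewrite -OmegaE cover; apply: eq_bigcupr => j _; rewrite TE'.
  by move=> i j ij; rewrite -!TE'; exact: disj.
have dotM j X Y Z W : dot (M j X - M j Y) (M j Z - M j W) = dot (X - Y) (Z - W).
  by rewrite !rigid_motion_sub rigid_motion_dot.
have enormM j X Y : enorm (M j X - M j Y) = enorm (X - Y).
  by rewrite /enorm dotM.
have tile_odd j : exists k : int, k%:~R = 1 :> 'F_2 /\
    quad_weight f g (M j A) (M j B) (M j C) (M j D) = k%:~R.
  have [||t [w [t1 wE ->]]] := trapezoid_weight fD gN (cxT j).
  - by rewrite dotM.
  - by rewrite dotM.
  rewrite !enormM -/h -/d -/c fhE fdE fcE.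
  exists (g t * fh + g w * fd - g (c^-1 *: (h *: t + d *: w)) * fc).
  split; first exact: oddP.
  by rewrite intrB intrD !intrM.
(* opposite sides of the square have opposite directions *)
have square_weight : quad_weight f g A0 B0 C0 D0 = 0.
  have [_ [_ [_ _ pyth0 rC0' _]]] := trapezoid_frame cx0 rA0 rB0.
  have [t [w [_ _ ->]]] := trapezoid_weight fD gN cx0 rA0 rB0.
  have [AB0 BC0 _ _] := convex_quadrilateral_neq cx0.
  have bc : enorm (C0 - B0) != 0 by rewrite gt_eqF // enorm_gt0 subr_eq0 eq_sym.
  have ab : enorm (B0 - A0) != 0 by rewrite gt_eqF // enorm_gt0 subr_eq0 eq_sym.
  have d0' : enorm (C0 - B0) - enorm (A0 - D0) = 0.
    by apply: (mulfI bc); rewrite -rC0' rC0 mulr0.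
  have ch : enorm (D0 - C0) = enorm (B0 - A0).
    apply/eqP; rewrite -(eqrXn2 (n := 2)) // ?sqrtr_ge0 //.
    by rewrite pyth0 d0' expr0n addr0.
  rewrite d0' ch scale0r addr0 scalerA mulVf // scale1r (additive0 fD) mulr0.
  by rewrite addr0 subrr.
have {tile_odd} [k kP] := choice tile_odd.
move: sumE; rewrite square_weight mulr0 => sum0.
have : \sum_(j < N) (-1) ^+ e j * k j = 0 :> int.
  apply: (@intr_inj rat); rewrite rmorph_sum /= -[RHS]sum0.
  by apply: eq_bigr => j _; rewrite (kP j).2 intrM rmorph_sign.
move=> /(congr1 (fun z : int => z%:~R : 'F_2)).
rewrite rmorph_sum /= (eq_bigr (fun=> 1)) => [|j _]; last first.
  by rewrite intrM (kP j).1 mulr1 rmorph_sign; case: (e j); apply: val_inj.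
by rewrite sumr_const card_ord => /natr_F2_eq0.
Qed.
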